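(* Let $V_{AB}$ be a normal bipartite quantum covariance matrix (QCM) with purification $\gamma_{ABE}$. Then $$E^{G}_{F,2}(V_{AB}) = \inf_{\Gamma_E}\sup_{\Gamma_A,\Gamma_B} I_M(A:B|E)_{\gamma_{ABE}+\Gamma_A\oplus\Gamma_B\oplus\Gamma_E} = \sup_{\Gamma_A,\Gamma_B}\inf_{\Gamma_E} I_M(A:B|E)_{\gamma_{ABE}+\Gamma_A\oplus\Gamma_B\oplus\Gamma_E},$$ where $\Gamma_A,\Gamma_B,\Gamma_E$ range over all QCMs on the systems $A,B,E$, respectively.
   Context: For an $m$-mode system, with phase-space coordinates ordered as $(x_1,\dots,x_m,p_1,\dots,p_m)$ and $\Omega=\begin{pmatrix}0&\mathbb 1\\-\mathbb 1&0\end{pmatrix}$, a QCM is a real symmetric $2m\times 2m$ matrix $V$ with $V\ge i\Omega$; it is pure iff $\det V=1$. A real matrix $S$ is symplectic if $S\Omega S^\intercal=\Omega$. For composite systems phase spaces and symplectic forms compose by direct sum ($\Omega_{AB}=\Omega_A\oplus\Omega_B$), and $V_A$, $V_{AE}$, etc. denote principal blocks. A bipartite QCM $V_{AB}$ is *normal* if there are symplectic matrices $S_A,S_B$ such that $(S_A\oplus S_B)V_{AB}(S_A\oplus S_B)^\intercal$ is in $xp$-form, i.e. all its entries between an $x$ coordinate and a $p$ coordinate (of any modes of $AB$) vanish. A purification of $V_{AB}$ is a pure QCM $\gamma_{ABE}$ (for some system $E$) whose $AB$ block is $V_{AB}$. For a positive definite matrix $W_{ABE}$, $$I_M(A:B|E)_W=\tfrac12\log_2\frac{(\det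 W_{AE})(\det W_{BE})}{(\det W_E)(\det W_{ABE})}$$ is the log-determinant conditional mutual information. Rényi-$2$ Gaussian entanglement of formation: $E^{G}_{F,2}(V_{AB})=\inf\{\frac12\log_2\det\gamma_A:\ \gamma_{AB}\text{ a pure QCM},\ i\Omega_{AB}\le\gamma_{AB}\le V_{AB}\}$. *)

(* Defs.v *)
From mathcomp Require Import all_boot all_order all_algebra.
From mathcomp Require Import complex.
From mathcomp Require Import all_classical all_reals all_analysis.

Set Implicit Arguments.
Unset Strict Implicit.
Unset Printing Implicit Defensive.

Import Order.TTheory GRing.Theory Num.Theory.
Local Open Scope classical_set_scope.
Local Open Scope ring_scope.
Local Open Scope sesquilinear_scope.

Definition psdmx (C : numClosedFieldType) (n : nat) (H : 'M[C]_n) : Prop :=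
  H \is hermsymmx /\ forall z : 'rV[C]_n, 0 <= (z *m H *m z^t*) 0 0.

Definition loewner_le (C : numClosedFieldType) (n : nat) (H K : 'M[C]_n) : Prop :=
  psdmx (K - H).

Definition cplx_mx (R : rcfType) (n : nat) (A : 'M[R]_n) : 'M[R[i]]_n :=
  map_mx (real_complex R) A.

Definition dirsum (R : pzRingType) (m n : nat) (A : 'M[R]_m) (B : 'M[R]_n) :
  'M[R]_(m + n) := block_mx A 0 0 B.

(* An m-mode system has phase space of dimension m + m: the left summand indexes
   x_1, ..., x_m and the right one p_1, ..., p_m. *)
Definition Omega (R : pzRingType) (m : nat) : 'M[R]_(m + m) :=
  block_mx 0 1%:M (- 1%:M) 0.
Arguments Omega {R} m.

Definition OmegaAB (R : pzRingType) (mA mB : nat) :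
  'M[R]_((mA + mA) + (mB + mB)) := dirsum (Omega mA) (Omega mB).
Arguments OmegaAB {R} mA mB.

Definition OmegaABE (R : pzRingType) (mA mB mE : nat) :
  'M[R]_((mA + mA) + (mB + mB) + (mE + mE)) := dirsum (OmegaAB mA mB) (Omega mE).
Arguments OmegaABE {R} mA mB mE.

Definition uncertainty (R : rcfType) (n : nat) (Om V : 'M[R]_n) : Prop :=
  loewner_le ('i%C *: cplx_mx Om) (cplx_mx V).

(* Parametrised by the symplectic form Om, so as to serve single and composite
   systems alike. *)
Definition is_qcm (R : rcfType) (n : nat) (Om V : 'M[R]_n) : Prop :=
  V^T = V /\ uncertainty Om V.

Definition is_pure_qcm (R : rcfType) (n : nat) (Om V : 'M[R]_n) : Prop :=
  is_qcm Om V /\ \det V = 1.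

Definition symplectic (R : pzRingType) (n : nat) (Om S : 'M[R]_n) : Prop :=
  S *m Om *m S^T = Om.

Definition is_x_coord (mA mB : nat) (k : 'I_((mA + mA) + (mB + mB))) : bool :=
  match fintype.split k with
  | inl a => (a < mA)%N
  | inr b => (b < mB)%N
  end.

Definition xp_form (R : pzRingType) (mA mB : nat)
    (V : 'M[R]_((mA + mA) + (mB + mB))) : Prop :=
  forall i j, is_x_coord i != is_x_coord j -> V i j = 0.

Definition normal_qcm (R : rcfType) (mA mB : nat)
    (V : 'M[R]_((mA + mA) + (mB + mB))) : Prop :=
  is_qcm (OmegaAB mA mB) V /\
  exists (SA : 'M[R]_(mA + mA)) (SB : 'M[R]_(mB + mB)),
    [/\ symplectic (Omega mA) SA, symplectic (Omega mB) SB &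
        xp_form (dirsum SA SB *m V *m (dirsum SA SB)^T)].

Definition purification (R : rcfType) (mA mB mE : nat)
    (V : 'M[R]_((mA + mA) + (mB + mB)))
    (gam : 'M[R]_((mA + mA) + (mB + mB) + (mE + mE))) : Prop :=
  is_pure_qcm (OmegaABE mA mB mE) gam /\ ulsubmx gam = V.

Definition blockAE (R : Type) (a b e : nat) (W : 'M[R]_(a + b + e)) : 'M[R]_(a + e) :=
  block_mx (ulsubmx (ulsubmx W)) (usubmx (ursubmx W))
           (lsubmx (dlsubmx W)) (drsubmx W).

Definition blockBE (R : Type) (a b e : nat) (W : 'M[R]_(a + b + e)) : 'M[R]_(b + e) :=
  block_mx (drsubmx (ulsubmx W)) (dsubmx (ursubmx W))
           (rsubmx (dlsubmx W)) (drsubmx W).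

Definition blockE (R : Type) (a b e : nat) (W : 'M[R]_(a + b + e)) : 'M[R]_e :=
  drsubmx W.

Definition log2 (R : realType) (x : R) : R := ln x / ln 2.

(* a, b, e are phase-space dimensions, i.e. twice the numbers of modes. *)
Definition cond_mutual_info (R : realType) (a b e : nat) (W : 'M[R]_(a + b + e)) : R :=
  2^-1 * log2 ((\det (blockAE W) * \det (blockBE W)) / (\det (blockE W) * \det W)).

(* The infimum is taken in the extended reals, so no boundedness is presupposed. *)
Definition EF2G (R : realType) (mA mB : nat)
    (V : 'M[R]_((mA + mA) + (mB + mB))) : \bar R :=
  ereal_inf [set (2^-1 * log2 (\det (ulsubmx gam)))%:E | gam in
    [set gam : 'M[R]_((mA + mA) + (mB + mB)) |
      [/\ is_pure_qcm (OmegaAB mA mB) gam, uncertainty (OmegaAB mA mB) gam &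
          loewner_le (cplx_mx gam) (cplx_mx V)]]].

Definition qcm_set (R : realType) (m : nat) : set 'M[R]_(m + m) :=
  [set G | is_qcm (Omega m) G].
Arguments qcm_set {R} m.

Definition measured_info (R : realType) (mA mB mE : nat)
    (gam : 'M[R]_((mA + mA) + (mB + mB) + (mE + mE)))
    (GA : 'M[R]_(mA + mA)) (GB : 'M[R]_(mB + mB)) (GE : 'M[R]_(mE + mE)) : \bar R :=
  (cond_mutual_info (gam + dirsum (dirsum GA GB) GE))%:E.

(* Main.v *)
(* Writing gam = [[V, C], [C^T, W]], a measurement of E with seed GE leaves AB in the state
   t = V - C (W + GE)^-1 C^T, and cond_mutual_info becomes the log-determinant mutual information
   of t + GA (+) GB (Schur complements).  It suffices to prove EF <= sup inf and inf sup <= EF.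

   inf sup <= EF.  Every QCM g <= V can be approximated by such a t, both from above and from below
   up to a factor close to 1.  If V > i Om one would take (W + GE)^-1 = Z := L (V - g) L^T, with L a
   right inverse of C; purity of gam gives W + i om = C^T (V + i Om)^-1 C, from which
   Z^-1 >= W + i om.  In general (V may have pure parts) L is built from the group inverse of
   C om C^T Om, and Z is perturbed to become invertible.  For pure g the mutual information of
   g + GA (+) GB is at most 1/2 log2 det g_A: measuring B leaves a QCM A' <= A := g_A on A, hence
   A' >= Om A'^-1 Om^T >= Om A^-1 Om^T, and submodularity of log det reduces
   det (A + GA) <= det A det (Om A^-1 Om^T + GA) to the case of a pure state below A.

   EF <= sup inf.  In xp-form, let GA and GB be almost perfect measurements of the positions.  If t
   has position covariance q, then q^-1 is at most the momentum covariance of t, so the pure state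
   q (+) q^-1 lies below V: this is the step which needs normality.  The mutual information
   of this pure state is that of its positions, so data processing concludes. *)
Require Import Defs.
From mathcomp Require Import all_boot all_order all_algebra.
From mathcomp Require Import complex.
From mathcomp Require Import all_classical all_reals all_analysis.
From mathcomp Require Import ring lra.

Set Implicit Arguments.
Unset Strict Implicit.
Unset Printing Implicit Defensive.

Import Order.TTheory GRing.Theory Num.Theory.
Local Open Scope classical_set_scope.
Local Open Scope ring_scope.

(** * Bilinear forms of matrices on row vectors *)

Definition bf (R : comPzRingType) m n (A : 'M[R]_(m, n)) (u : 'rV[R]_m) (v : 'rV[R]_n) : R :=
  (u *m A *m v^T) 0 0.

Section BilinearForm.
Context {R : comPzRingType}.

Lemma bfDl m n (A : 'M[R]_(m, n)) u v w : bf A (u + v) w = bf A u w + bf A v w.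
Proof. by rewrite /bf !mulmxDl mxE. Qed.

Lemma bfDr m n (A : 'M[R]_(m, n)) u v w : bf A u (v + w) = bf A u v + bf A u w.
Proof. by rewrite /bf linearD mulmxDr mxE. Qed.

Lemma bfZl m n (A : 'M[R]_(m, n)) a u v : bf A (a *: u) v = a * bf A u v.
Proof. by rewrite /bf -!scalemxAl mxE. Qed.

Lemma bfZr m n (A : 'M[R]_(m, n)) a u v : bf A u (a *: v) = a * bf A u v.
Proof. by rewrite /bf linearZ -scalemxAr mxE. Qed.

Lemma bfNl m n (A : 'M[R]_(m, n)) u v : bf A (- u) v = - bf A u v.
Proof. by rewrite /bf !mulNmx mxE. Qed.

Lemma bfNr m n (A : 'M[R]_(m, n)) u v : bf A u (- v) = - bf A u v.
Proof. by rewrite /bf linearN mulmxN mxE. Qed.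

Lemma bf0r m n (A : 'M[R]_(m, n)) u : bf A u 0 = 0.
Proof. by rewrite /bf trmx0 mulmx0 mxE. Qed.

Lemma bf0l m n (A : 'M[R]_(m, n)) u : bf A 0 u = 0.
Proof. by rewrite /bf !mul0mx mxE. Qed.

Lemma bfmxD m n (A B : 'M[R]_(m, n)) u v : bf (A + B) u v = bf A u v + bf B u v.
Proof. by rewrite /bf mulmxDr mulmxDl mxE. Qed.

Lemma bfmxN m n (A : 'M[R]_(m, n)) u v : bf (- A) u v = - bf A u v.
Proof. by rewrite /bf mulmxN mulNmx mxE. Qed.

Lemma bfmxB m n (A B : 'M[R]_(m, n)) u v : bf (A - B) u v = bf A u v - bf B u v.
Proof. by rewrite bfmxD bfmxN. Qed.

Lemma bfmxZ m n a (A : 'M[R]_(m, n)) u v : bf (a *: A) u v = a * bf A u v.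
Proof. by rewrite /bf -scalemxAr -scalemxAl mxE. Qed.

Lemma bfmx0 m n u v : bf (0 : 'M[R]_(m, n)) u v = 0.
Proof. by rewrite /bf mulmx0 mul0mx mxE. Qed.

Lemma bf_tr m n (A : 'M[R]_(m, n)) u v : bf A^T u v = bf A v u.
Proof. by rewrite /bf -[RHS](mxE trmx_key (fun i j => (v *m A *m u^T) j i)) -/(trmx _) !trmx_mul !trmxK mulmxA. Qed.

Lemma bfMl m n p (B : 'M[R]_(p, m)) (A : 'M[R]_(m, n)) u v :
  bf A (u *m B) v = bf (B *m A) u v.
Proof. by rewrite /bf !mulmxA. Qed.

Lemma bfMr m n p (B : 'M[R]_(p, n)) (A : 'M[R]_(m, n)) u v :
  bf A u (v *m B) = bf (A *m B^T) u v.
Proof. by rewrite /bf trmx_mul !mulmxA. Qed.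

Lemma bf_block m1 m2 n1 n2 (A : 'M[R]_(m1, n1)) (B : 'M[R]_(m1, n2)) (C : 'M[R]_(m2, n1))
    (D : 'M[R]_(m2, n2)) a b c d :
  bf (block_mx A B C D) (row_mx a b) (row_mx c d) = bf A a c + bf B a d + bf C b c + bf D b d.
Proof.
rewrite /bf mul_row_block tr_row_mx mul_row_col !mulmxDl !mxE; ring.
Qed.

End BilinearForm.

(** * Real semidefinite matrices and the Loewner order *)

Definition psd (R : numDomainType) n (A : 'M[R]_n) : Prop :=
  A^T = A /\ forall u, 0 <= bf A u u.
Definition pd (R : numDomainType) n (A : 'M[R]_n) : Prop :=
  A^T = A /\ forall u, u != 0 -> 0 < bf A u u.

Section Semidefinite.
Context {R : realFieldType}.

Lemma bfC n (A : 'M[R]_n) u v : A^T = A -> bf A u v = bf A v u.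
Proof. by move=> sA; rewrite -bf_tr sA. Qed.

Lemma pd_psd n (A : 'M[R]_n) : pd A -> psd A.
Proof.
case=> sA pA; split=> // u; have [->|u0] := eqVneq u 0; first by rewrite bf0l.
exact/ltW/pA.
Qed.

Lemma psd0 n : psd (0 : 'M[R]_n).
Proof. by split=> [|u]; rewrite ?trmx0 ?bfmx0. Qed.

Lemma psdD n (A B : 'M[R]_n) : psd A -> psd B -> psd (A + B).
Proof.
move=> [sA pA] [sB pB]; split=> [|u]; first by rewrite linearD /= sA sB.
by rewrite bfmxD addr_ge0.
Qed.

Lemma psdZ n a (A : 'M[R]_n) : 0 <= a -> psd A -> psd (a *: A).
Proof.
move=> a0 [sA pA]; split=> [|u]; first by rewrite linearZ /= sA.
by rewrite bfmxZ mulr_ge0.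
Qed.

Lemma pdDr n (A B : 'M[R]_n) : pd A -> psd B -> pd (A + B).
Proof.
move=> [sA pA] [sB pB]; split=> [|u u0]; first by rewrite linearD /= sA sB.
by rewrite bfmxD ltr_wpDr // pA.
Qed.

Lemma pdZ n a (A : 'M[R]_n) : 0 < a -> pd A -> pd (a *: A).
Proof.
move=> a0 [sA pA]; split=> [|u u0]; first by rewrite linearZ /= sA.
by rewrite bfmxZ mulr_gt0 // pA.
Qed.

Lemma pd_le n (A B : 'M[R]_n) : pd A -> psd (B - A) -> pd B.
Proof. by move=> pA /(pdDr pA); rewrite addrC subrK. Qed.

Lemma psd_trans n (A B C : 'M[R]_n) : psd (B - A) -> psd (C - B) -> psd (C - A).
Proof. by move=> h /psdD/(_ h); rewrite addrA subrK. Qed.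

Lemma psd_congr m n (A : 'M[R]_n) (K : 'M[R]_(m, n)) : psd A -> psd (K *m A *m K^T).
Proof.
move=> [sA pA]; split=> [|u]; first by rewrite !trmx_mul trmxK sA mulmxA.
by rewrite -bfMr -bfMl.
Qed.

Lemma psd_congrB m n (A B : 'M[R]_n) (K : 'M[R]_(m, n)) :
  psd (A - B) -> psd (K *m A *m K^T - K *m B *m K^T).
Proof. by move/(psd_congr K); rewrite mulmxBr mulmxBl. Qed.

Lemma pd_congr m n (A : 'M[R]_n) (K : 'M[R]_(m, n)) : row_free K -> pd A -> pd (K *m A *m K^T).
Proof.
move=> fK [sA pA]; split=> [|u u0]; first by rewrite !trmx_mul trmxK sA mulmxA.
rewrite -bfMr -bfMl pA //; apply: contra u0 => /eqP e.
by apply/eqP/(row_free_inj fK); rewrite e mul0mx.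
Qed.

Lemma psd_ker n (A : 'M[R]_n) u : psd A -> bf A u u = 0 -> u *m A = 0.
Proof.
move=> [sA pA] u0; suff h v : bf A u v = 0.
  by apply/rowP=> j; move: (h (delta_mx 0 j)); rewrite /bf trmx_delta -colE !mxE.
apply/eqP/negP=> /negP b0.
(* As the form vanishes at [u], this multiple of [u] makes it equal to -1 at the tested vector. *)
have := pA (- (bf A v v + 1) / (2 * bf A u v) *: u + v).
rewrite !(bfDl, bfDr, bfZl, bfZr) u0 (bfC v u sA).
have -> : - (bf A v v + 1) / (2 * bf A u v) * bf A u v = - (bf A v v + 1) / 2 by field.
lra.
Qed.

Lemma psd_dominated_ker m n (A B : 'M[R]_n) (K : 'M[R]_(m, n)) :
  psd A -> psd (B - A) -> K *m B = 0 -> K *m A = 0.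
Proof.
move=> pA [_ pBA] KB; apply/row_matrixP=> i; rewrite row_mul row0; apply: psd_ker=> //.
apply/eqP; rewrite eq_le (proj2 pA) andbT.
have := pBA (row i K); rewrite bfmxB {1}/bf -row_mul KB row0 mul0mx mxE; lra.
Qed.

Lemma pd_unit n (A : 'M[R]_n) : pd A -> A \in unitmx.
Proof.
move=> [_ pA]; rewrite -row_free_unit; apply: inj_row_free => v vA; apply/eqP/negPn/negP=> /pA.
by rewrite /bf vA mul0mx mxE ltxx.
Qed.

Lemma pd_inv n (A : 'M[R]_n) : pd A -> pd (invmx A).
Proof.
move=> pA; have uA := pd_unit pA.
have -> : invmx A = invmx A *m A *m (invmx A)^T.
  by rewrite mulVmx // mul1mx trmx_inv (proj1 pA).
by apply: pd_congr => //; rewrite row_free_unit unitmx_inv.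
Qed.

Lemma pd_of_unit n (A : 'M[R]_n) : psd A -> A \in unitmx -> pd A.
Proof.
move=> pA uA; split=> [|u u0]; first exact: proj1 pA.
rewrite lt_neqAle (proj2 pA) andbT eq_sym; apply: contra u0 => /eqP /(psd_ker pA) e.
by apply/eqP; rewrite -[u](mulmxK uA) e mul0mx.
Qed.

Lemma pd1 n : pd (1%:M : 'M[R]_n).
Proof.
split=> [|u u0]; first by rewrite trmx1.
have h : bf 1%:M u u = \sum_i u 0 i ^+ 2.
  by rewrite /bf mulmx1 mxE; apply: eq_bigr => i _; rewrite mxE expr2.
rewrite h lt_neqAle sumr_ge0 ?andbT => [|i _]; last exact: sqr_ge0.
apply: contra u0; rewrite eq_sym => /eqP e; apply/eqP/rowP=> i; rewrite mxE.
by apply/eqP; rewrite -sqrf_eq0; apply/eqP; move: e i (erefl true); apply: psumr_eq0P => i _; exact: sqr_ge0.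
Qed.

(* Variational characterisation of the inverse: bf A^-1 v v is the maximum of 2 v w^T - bf A w w. *)
Lemma bf_inv_ge n (A : 'M[R]_n) v w : pd A -> 2 * bf 1%:M v w - bf A w w <= bf (invmx A) v v.
Proof.
move=> pA; have uA := pd_unit pA; have := proj2 (pd_psd pA) (v *m invmx A - w).
rewrite !(bfDl, bfDr, bfNl, bfNr) !bfMl !bfMr trmx_inv (proj1 pA) mulVmx // mulmxV // mul1mx.
rewrite (bfC w v (trmx1 _ _)); lra.
Qed.

(** The maximiser for [B], namely [u *m invmx B], is a competitor in the variational formula for
    [A]. *)
Lemma psd_inv_anti n (A B : 'M[R]_n) : pd A -> psd (B - A) -> psd (invmx A - invmx B).
Proof.
move=> pA pBA; have pB := pd_le pA pBA; have uB := pd_unit pB; split=> [|u].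
  by rewrite linearB /= !trmx_inv (proj1 pA) (proj1 pB).
have := bf_inv_ge u (u *m invmx B) pA; have := proj2 pBA (u *m invmx B).
rewrite !bfmxB !bfMl !bfMr trmx_inv (proj1 pB) mul1mx mulVmx // mul1mx; lra.
Qed.

Lemma psd_le_scal n (A : 'M[R]_n) : A^T = A -> exists2 c, 0 < c & psd (c%:M - A).
Proof.
(* The products [u 0 i * u 0 j] are bounded by the squared norm of [u]; the summand 1 keeps the
   constant positive even when [A] is zero. *)
move=> sA; exists (1 + \sum_i \sum_j `|A i j|).
  by rewrite ltr_pwDl // sumr_ge0 // => i _; rewrite sumr_ge0.
split=> [|u]; first by rewrite linearB /= tr_scalar_mx sA.
have e : bf 1%:M u u = \sum_i u 0 i ^+ 2.
  by rewrite /bf mulmx1 mxE; apply: eq_bigr => i _; rewrite mxE expr2.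
have n0 : 0 <= bf 1%:M u u by rewrite e sumr_ge0 // => i _; exact: sqr_ge0.
have l i : u 0 i ^+ 2 <= bf 1%:M u u.
  by rewrite e (bigD1 i) //= lerDl sumr_ge0 // => j _; exact: sqr_ge0.
rewrite bfmxB -scalemx1 bfmxZ subr_ge0 mulrDl mul1r -[leLHS]add0r lerD //.
have -> : bf A u u = \sum_i \sum_j A i j * (u 0 i * u 0 j).
  rewrite /bf -mulmxA mxE; apply: eq_bigr => i _; rewrite mxE mulr_sumr.
  by apply: eq_bigr => j _; rewrite mxE; ring.
rewrite mulr_suml; apply: ler_sum => i _; rewrite mulr_suml; apply: ler_sum => j _.
apply: le_trans (ler_norm _) _; rewrite normrM ler_wpM2l // ler_norml.
move: (l i) (l j) (sqr_ge0 (u 0 i - u 0 j)) (sqr_ge0 (u 0 i + u 0 j)) => *.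
apply/andP; split; nra.
Qed.

Lemma pd_ge_scal n (A : 'M[R]_n) : pd A -> exists2 c, 0 < c & psd (A - c%:M).
Proof.
move=> pA; have [c c0 h] := psd_le_scal (proj1 (pd_inv pA)).
exists c^-1; first by rewrite invr_gt0.
have := psd_inv_anti (pd_inv pA) h; rewrite invmxK invmx_scalar; exact.
Qed.

Lemma psd_le_pd n (A D : 'M[R]_n) : pd A -> D^T = D -> exists2 k, 0 < k & psd (k *: A - D).
Proof.
move=> pA sD; have [c c0 hc] := pd_ge_scal pA; have [d d0 hd] := psd_le_scal sD.
exists (d / c); first by rewrite divr_gt0.
apply: psd_trans hd _; have /psdZ/(_ hc) : 0 <= d / c by rewrite divr_ge0 ?ltW.
by rewrite scalerBr scale_scalar_mx divfK // gt_eqF.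
Qed.

End Semidefinite.

(** * Schur complements and block determinants *)

Section SchurComplement.
Context {F : fieldType}.

Lemma det_schur_dr m n (A : 'M[F]_m) B C (D : 'M[F]_n) : D \in unitmx ->
  \det (block_mx A B C D) = \det D * \det (A - B *m invmx D *m C).
Proof.
move=> uD.
have -> : block_mx A B C D =
    block_mx 1%:M (B *m invmx D) 0 1%:M *m block_mx (A - B *m invmx D *m C) 0 C D.
  rewrite mulmx_block !mul1mx !mul0mx !add0r; congr block_mx; first by rewrite subrK.
  by rewrite -mulmxA mulVmx // mulmx1.
by rewrite det_mulmx det_ublock det_lblock !det1 !mul1r mulrC.
Qed.

Lemma det_schur_ul m n (A : 'M[F]_m) B C (D : 'M[F]_n) : A \in unitmx ->
  \det (block_mx A B C D) = \det A * \det (D - C *m invmx A *m B).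
Proof.
move=> uA.
have -> : block_mx A B C D =
    block_mx 1%:M 0 (C *m invmx A) 1%:M *m block_mx A B 0 (D - C *m invmx A *m B).
  rewrite mulmx_block !mul1mx !mul0mx !addr0; congr block_mx.
    by rewrite -mulmxA mulVmx // mulmx1.
  by rewrite addrC subrK.
by rewrite det_mulmx det_ublock det_lblock !det1 !mul1r.
Qed.

(** The matrix determinant lemma: both sides are the determinant of one bordered matrix, expanded by
    its two Schur complements. *)
Lemma det_rank1_update n (A : 'M[F]_n) (u : 'cV[F]_n) (v : 'rV[F]_n) : A \in unitmx ->
  \det (A + u *m v) = \det A * (1 + (v *m invmx A *m u) 0 0).
Proof.
move=> uA; transitivity (\det (block_mx A (- u) v (1%:M : 'M[F]_1))).
  by rewrite det_schur_dr ?unitmx1 // det1 mul1r invmx1 mulmx1 mulNmx opprK.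
by rewrite det_schur_ul // mulmxN opprK [X in _ * X]det_mx11 !mxE.
Qed.

End SchurComplement.

(** * Cholesky factors; monotonicity and submodularity of the determinant *)

Section Determinants.
Context {R : rcfType}.

Lemma psd_block_ul m n (A : 'M[R]_m) B C (D : 'M[R]_n) : psd (block_mx A B C D) -> psd A.
Proof.
move=> [s p]; move: s; rewrite tr_block_mx => /eq_block_mx[sA _ _ _]; split=> // u.
by have := p (row_mx u 0); rewrite bf_block !bf0r !bf0l !addr0.
Qed.

Lemma psd_block_dr m n (A : 'M[R]_m) B C (D : 'M[R]_n) : psd (block_mx A B C D) -> psd D.
Proof.
move=> [s p]; move: s; rewrite tr_block_mx => /eq_block_mx[_ _ _ sD]; split=> // u.
by have := p (row_mx 0 u); rewrite bf_block !bf0r !bf0l !add0r.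
Qed.

Lemma pd_block_ul m n (A : 'M[R]_m) B C (D : 'M[R]_n) : pd (block_mx A B C D) -> pd A.
Proof.
move=> [s p]; move: s; rewrite tr_block_mx => /eq_block_mx[sA _ _ _]; split=> // u u0.
have := p (row_mx u 0); rewrite bf_block !bf0r !bf0l !addr0; apply.
by apply: contra u0; rewrite -row_mx0 => /eqP /eq_row_mx[-> _].
Qed.

Lemma pd_block_dr m n (A : 'M[R]_m) B C (D : 'M[R]_n) : pd (block_mx A B C D) -> pd D.
Proof.
move=> [s p]; move: s; rewrite tr_block_mx => /eq_block_mx[_ _ _ sD]; split=> // u u0.
have := p (row_mx 0 u); rewrite bf_block !bf0r !bf0l !add0r; apply.
by apply: contra u0; rewrite -row_mx0 => /eqP /eq_row_mx[_ ->].
Qed.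

(** The block form is tested at [row_mx u (- u *m B *m invmx D)], its minimiser over the second
    component. *)
Lemma psd_schur m n (A : 'M[R]_m) B C (D : 'M[R]_n) : pd D -> psd (block_mx A B C D) ->
  psd (A - B *m invmx D *m C).
Proof.
move=> pD [s p]; have uD := pd_unit pD; move: s; rewrite tr_block_mx => /eq_block_mx[sA eB eC sD].
split=> [|u]; first by rewrite linearB /= !trmx_mul trmx_inv sA sD eB eC mulmxA.
have := p (row_mx u (- u *m B *m invmx D)).
rewrite bf_block bfmxB !(bfMl, bfMr) !(bfNl, bfNr) trmx_inv sD !mulmxA.
have -> : B^T = C by rewrite -eB trmxK.
by rewrite -[B *m invmx D *m D]mulmxA mulVmx // mulmx1; lra.
Qed.

Lemma pd_schur m n (A : 'M[R]_m) B C (D : 'M[R]_n) : pd (block_mx A B C D) ->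
  pd (A - B *m invmx D *m C).
Proof.
move=> p; have pD := pd_block_dr p; apply: pd_of_unit; first exact: psd_schur (pd_psd p).
have := pd_unit p; rewrite !unitmxE det_schur_dr ?pd_unit // unitrM; by case/andP.
Qed.

(** Induction on the size: a nonzero pivot is eliminated by a Schur complement, and a zero pivot
    makes its row vanish by [psd_ker]. *)
Lemma psd_cholesky n (A : 'M[R]_n) : psd A -> exists K : 'M[R]_n, A = K^T *m K.
Proof.
elim: n A => [|n IH] A pA; first by exists 0; rewrite [A]flatmx0 mulmx0.
move: A pA; change n.+1 with (1 + n)%N => A.
rewrite -[A]submxK; move: (ulsubmx A) (ursubmx A) (dlsubmx A) (drsubmx A) => a b c D p.
have [s _] := p; move: s; rewrite tr_block_mx => /eq_block_mx[_ eb ec sD].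
have ca : a = (a 0 0)%:M by rewrite [LHS]mx11_scalar.
have a0 : 0 <= a 0 0.
  have := proj2 (psd_block_ul p) 1%:M; rewrite /bf mul1mx trmx1 mulmx1; exact.
have [z|nz] := eqVneq (a 0 0) 0.
  have [K hK] := IH _ (psd_block_dr p); exists (block_mx 0 0 0 K).
  have := @psd_ker _ _ _ (row_mx 1%:M 0) p.
  rewrite bf_block !bf0l !bf0r !addr0 ca z raddf0 bfmx0 => /(_ erefl).
  rewrite mul_row_block !mul1mx !mul0mx !addr0 -[RHS]row_mx0 => /eq_row_mx[_ b0].
  have c0 : c = 0 by rewrite -ec b0 trmx0.
  by rewrite tr_block_mx mulmx_block !trmx0 !mulmx0 !mul0mx !addr0 add0r -hK b0 c0.
have pa : pd a.
  split=> [|u u0]; first by rewrite ca tr_scalar_mx.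
  rewrite ca -scalemx1 bfmxZ mulr_gt0 //; last exact: (proj2 (pd1 _)).
  by rewrite lt_neqAle eq_sym nz a0.
have p' : psd (D - c *m invmx a *m b).
  apply: (psd_schur pa); split.
    by rewrite tr_block_mx (proj1 pa) eb ec sD.
  move=> u; rewrite -[u]hsubmxK bf_block.
  have := proj2 p (row_mx (rsubmx u) (lsubmx u)); rewrite bf_block; lra.
have [K hK] := IH _ p'.
have s2 : Num.sqrt (a 0 0) * Num.sqrt (a 0 0) = a 0 0 by rewrite -expr2 sqr_sqrtr.
have s0 : Num.sqrt (a 0 0) != 0 by apply: contra nz => /eqP e; rewrite -s2 e mul0r.
exists (block_mx (Num.sqrt (a 0 0))%:M ((Num.sqrt (a 0 0))^-1 *: b) 0 K).
rewrite tr_block_mx mulmx_block !tr_scalar_mx !trmx0 !mul0mx !mulmx0 !addr0.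
have -> : ((Num.sqrt (a 0 0))^-1 *: b)^T = (Num.sqrt (a 0 0))^-1 *: c.
  by rewrite linearZ /= ec.
rewrite -hK !mul_scalar_mx mul_mx_scalar !scalerA mulfV // !scale1r.
rewrite scale_scalar_mx s2 -ca; congr block_mx.
have ia : c *m invmx a *m b = (a 0 0)^-1 *: (c *m b).
  by rewrite {1}ca invmx_scalar mul_mx_scalar -scalemxAl.
by rewrite -scalemxAl -scalemxAr scalerA -invfM s2 ia addrC subrK.
Qed.

Lemma psd_rank1_sum n (A : 'M[R]_n) : psd A ->
  exists s : seq 'rV[R]_n, A = \sum_(v <- s) v^T *m v.
Proof.
move=> /psd_cholesky[K ->]; exists [seq row i K | i <- enum 'I_n].
rewrite big_map big_enum; apply/matrixP=> i j; rewrite mxE summxE; apply: eq_bigr => k _.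
by rewrite !mxE big_ord1 !mxE.
Qed.

Lemma psd_rank1 n (v : 'rV[R]_n) : psd (v^T *m v).
Proof. by have := psd_congr v^T (pd_psd (pd1 1)); rewrite mulmx1 trmxK. Qed.

Lemma psd_rank1s n (s : seq 'rV[R]_n) : psd (\sum_(v <- s) v^T *m v).
Proof.
elim: s => [|v s IH]; rewrite ?big_nil ?big_cons; first exact: psd0.
by apply: psdD IH; apply: psd_rank1.
Qed.

Lemma pd_det_gt0 n (A : 'M[R]_n) : pd A -> 0 < \det A.
Proof.
move=> pA; have [K e] := psd_cholesky (pd_psd pA).
have := pd_unit pA; rewrite unitmxE e det_mulmx det_tr unitfE mulf_eq0 orbb => h.
by rewrite lt_neqAle sqr_ge0 andbT eq_sym mulf_neq0.
Qed.

(** Each update by [v] multiplies a determinant by one plus the form of the inverse at [v], and the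
    larger matrix has the smaller inverse. *)
Lemma det_rank1s_submod n (M M' : 'M[R]_n) (s : seq 'rV[R]_n) : pd M -> psd (M' - M) ->
  \det M * \det (M' + \sum_(v <- s) v^T *m v) <= \det M' * \det (M + \sum_(v <- s) v^T *m v).
Proof.
move=> pM pMM; have pM' := pd_le pM pMM.
elim: s => [|v s IH]; rewrite ?big_nil ?addr0; first by rewrite mulrC.
rewrite !big_cons; set H := \sum_(_ <- _) _ in IH *; have pH : psd H by exact: psd_rank1s.
have p1 := pdDr pM pH; have p2 := pdDr pM' pH.
rewrite ![v^T *m v + H]addrC !addrA !det_rank1_update ?pd_unit // !mulrA.
apply: ler_pM => //; first by rewrite mulr_ge0 // ltW // pd_det_gt0.
  by rewrite addr_ge0 // (proj2 (pd_psd (pd_inv p2)) v).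
rewrite lerD2l; have /psd_inv_anti : pd (M + H) by []; move/(_ (M' + H)).
have -> : M' + H - (M + H) = M' - M by rewrite opprD addrACA subrr addr0.
move/(_ pMM) => [_ /(_ v)]; rewrite bfmxB /bf; lra.
Qed.

Lemma det_submod n (M M' H : 'M[R]_n) : pd M -> psd (M' - M) -> psd H ->
  \det M * \det (M' + H) <= \det M' * \det (M + H).
Proof. by move=> pM pMM /psd_rank1_sum[s ->]; apply: det_rank1s_submod. Qed.

Lemma det_rank1s_ge n (M : 'M[R]_n) (s : seq 'rV[R]_n) : pd M ->
  \det M <= \det (M + \sum_(v <- s) v^T *m v).
Proof.
move=> pM; elim: s => [|v s IH]; rewrite ?big_nil ?addr0 // big_cons.
have p1 := pdDr pM (psd_rank1s s).
rewrite [v^T *m v + _]addrC addrA det_rank1_update ?pd_unit //.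
apply: le_trans IH _; rewrite -[leLHS]mulr1 ler_pM2l ?pd_det_gt0 // lerDl.
exact: (proj2 (pd_psd (pd_inv p1)) v).
Qed.

Lemma det_le n (A B : 'M[R]_n) : pd A -> psd (B - A) -> \det A <= \det B.
Proof. by move=> pA /psd_rank1_sum[s e]; rewrite -[B](subrK A) e addrC det_rank1s_ge. Qed.

(** Any rank-one term of [B - A] with nonzero [v] would already raise the determinant strictly. *)
Lemma det_le_eq n (A B : 'M[R]_n) : pd A -> psd (B - A) -> \det A = \det B -> A = B.
Proof.
move=> pA pBA; have [s e] := psd_rank1_sum pBA.
suff h (v : 'rV[R]_n) : v \in s -> \det A = \det B -> v = 0.
  move=> d; apply/esym/eqP; rewrite -subr_eq0 e big_seq big1 // => v /h ->//.
  by rewrite mulmx0.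
move=> vs; have -> : B = (A + v^T *m v) + \sum_(w <- rem v s) w^T *m w.
  by rewrite -addrA -[B](subrK A) e (perm_big _ (perm_to_rem vs)) big_cons addrC.
move=> d; have := det_rank1s_ge (rem v s) (pdDr pA (psd_rank1 v)).
rewrite -d det_rank1_update ?pd_unit // -[leRHS]mulr1 ler_pM2l ?pd_det_gt0 //.
have [->|/(proj2 (pd_inv pA) v)] := eqVneq v 0 => //.
by rewrite /bf => h1; rewrite gerDl leNgt h1.
Qed.

Lemma pd_block_swap a b (A : 'M[R]_a) C D (B : 'M[R]_b) :
  pd (block_mx A C D B) -> pd (block_mx B D C A).
Proof.
move=> [s p]; move: s; rewrite tr_block_mx => /eq_block_mx[sA eC eD sB].
split; first by rewrite tr_block_mx sA sB eC eD.
move=> u; rewrite -[u]hsubmxK => u0; rewrite bf_block.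
have := p (row_mx (rsubmx u) (lsubmx u)); rewrite bf_block.
have -> : row_mx (rsubmx u) (lsubmx u) != 0.
  by apply: contra u0; rewrite -!row_mx0 => /eqP/eq_row_mx[-> ->].
move/(_ isT); lra.
Qed.

(** One-sided data processing, multiplied out. Through Schur complements it reduces to
    [X^T *m invmx (X *m A *m X^T) *m X] lying below [invmx A]. *)
Lemma det_compress_ul a b k (A : 'M[R]_a) C (B : 'M[R]_b) (X : 'M[R]_(k, a)) :
  row_free X -> pd (block_mx A C C^T B) ->
  \det (X *m A *m X^T) * \det (block_mx A C C^T B) <=
  \det A * \det (block_mx (X *m A *m X^T) (X *m C) (X *m C)^T B).
Proof.
move=> fX p; have pA := pd_block_ul p; have pX := pd_congr fX pA.
have uA := pd_unit pA; have uX := pd_unit pX.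
rewrite !det_schur_ul // mulrCA ler_pM2l ?pd_det_gt0 // ler_pM2l ?pd_det_gt0 //.
have p' := pd_block_swap p.
apply: det_le (pd_schur p') _.
rewrite opprB addrA addrAC [B - _ - B]addrAC subrr add0r addrC trmx_mul.
set Y := invmx (X *m A *m X^T); have sY : Y^T = Y by rewrite trmx_inv (proj1 pX).
have -> : C^T *m invmx A *m C - C^T *m X^T *m Y *m (X *m C) =
    C^T *m (invmx A - X^T *m Y *m X) *m C^T^T.
  by rewrite trmxK mulmxBr mulmxBl !mulmxA.
apply: psd_congr; split=> [|v].
  by rewrite linearB /= !trmx_mul trmxK trmx_inv sY (proj1 pA) mulmxA.
have := bf_inv_ge v (v *m X^T *m Y *m X) pA.
rewrite bfmxB !bfMl !bfMr trmxK sY mul1mx -!mulmxA.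
have -> : X *m (A *m (X^T *m (Y *m X))) = (X *m A *m X^T) *m Y *m X by rewrite !mulmxA.
rewrite mulmxV // mul1mx; lra.
Qed.

Lemma det_block_swap a b (A : 'M[R]_a) C D (B : 'M[R]_b) : A \in unitmx ->
  \det (block_mx A C D B) = \det (block_mx B D C A).
Proof. by move=> uA; rewrite det_schur_ul // det_schur_dr. Qed.

End Determinants.

(** * Complex Hermitian positivity in real terms *)

Section ComplexForms.
Context {R : rcfType}.

Let cmx m n (A : 'M[R]_(m, n)) : 'M[R[i]]_(m, n) := map_mx (real_complex R) A.

Lemma complex_formE n (P Q : 'M[R]_n) (x y : 'rV[R]_n) :
  let z : 'rV[R[i]]_n := cmx x + 'i%C *: cmx y in
  (z *m (cplx_mx P + 'i%C *: cplx_mx Q) *m (map_mx Num.conj z^T)) 0 0 =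
  Complex (bf P x x + bf P y y + bf Q x y - bf Q y x)
          (bf P y x - bf P x y + bf Q x x + bf Q y y).
Proof.
have e A u v : bf (cplx_mx A) (cmx u) (cmx v) = (bf A u v)%:C%C :> R[i].
  by rewrite /bf map_trmx -!map_mxM mxE.
move=> z.
have -> : map_mx Num.conj z^T = (cmx x - 'i%C *: cmx y)^T.
  by apply/matrixP=> i j; rewrite !mxE; apply/eqP; rewrite eq_complex /=; simpc.
rewrite -/(bf _ z _) /z !(bfDl, bfDr, bfNr, bfZl, bfZr, bfmxD, bfmxZ) !e.
by apply/eqP; rewrite eq_complex /=; apply/andP; split; apply/eqP; ring.
Qed.

(** Here [x] and [y] are the real and imaginary parts of the complex vector; the symmetries of [P]
    and [Q] make the imaginary part of the form vanish. *)
Lemma complex_psdP n (P Q : 'M[R]_n) : P^T = P -> Q^T = - Q ->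
  psdmx (cplx_mx P + 'i%C *: cplx_mx Q) <->
  forall x y, 0 <= bf P x x + bf P y y + 2 * bf Q x y.
Proof.
move=> sP sQ.
have hs : cplx_mx P + 'i%C *: cplx_mx Q \is hermitianmx n false Num.conj.
  apply/is_hermitianmxP/matrixP=> i j; rewrite expr0 scale1r !mxE.
  have := congr1 (fun M : 'M[R]_n => M i j) sP; have := congr1 (fun M : 'M[R]_n => M i j) sQ.
  rewrite !mxE => eq ep; apply/eqP; rewrite eq_complex /=.
  by apply/andP; split; apply/eqP; rewrite ?eq -?ep; ring.
have aQ u v : bf Q v u = - bf Q u v by rewrite -bf_tr sQ bfmxN.
have f x y : bf P x x + bf P y y + bf Q x y - bf Q y x = bf P x x + bf P y y + 2 * bf Q x y.
  by rewrite (aQ x y); ring.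
split=> [[_ h] x y|h].
  have := h (cmx x + 'i%C *: cmx y); rewrite complex_formE lecE /= f; by case/andP.
split=> // z.
have -> : z = cmx (map_mx (fun c => complex.Re c) z) + 'i%C *: cmx (map_mx (fun c => complex.Im c) z).
  by apply/rowP=> j; rewrite !mxE -complexE.
rewrite complex_formE lecE /= f h andbT; apply/eqP.
have d u : bf Q u u = 0 by have := aQ u u; lra.
by rewrite !d (bfC _ _ sP); ring.
Qed.

Lemma loewner_leP n (A B : 'M[R]_n) : A^T = A -> B^T = B ->
  loewner_le (cplx_mx A) (cplx_mx B) <-> psd (B - A).
Proof.
move=> sA sB; rewrite /loewner_le.
have -> : cplx_mx B - cplx_mx A = cplx_mx (B - A) + 'i%C *: cplx_mx 0.
  by rewrite /cplx_mx raddf0 scaler0 addr0 raddfB.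
have s : (B - A)^T = B - A by rewrite linearB /= sA sB.
rewrite complex_psdP ?trmx0 ?oppr0 //; split=> h.
  by split=> // u; have := h u 0; rewrite bf0l bfmx0 mulr0 !addr0.
by move=> x y; rewrite bfmx0 mulr0 addr0 addr_ge0 // (proj2 h).
Qed.

(** Replacing [y] by [- y] flips the sign of [Om], so that sign is immaterial in the real
    condition. *)
Lemma uncertaintyP n (Om V : 'M[R]_n) : Om^T = - Om -> V^T = V ->
  uncertainty Om V <-> forall x y, 0 <= bf V x x + bf V y y + 2 * bf Om x y.
Proof.
move=> aO sV; rewrite /uncertainty /loewner_le.
have -> : cplx_mx V - 'i%C *: cplx_mx Om = cplx_mx V + 'i%C *: cplx_mx (- Om).
  by rewrite /cplx_mx raddfN /= scalerN.
rewrite complex_psdP //; last by rewrite linearN /= aO.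
split=> h x y; have := h x (- y); rewrite ?bfmxN !bfNr bfNl; lra.
Qed.

End ComplexForms.

(** * Covariance matrices: duality, purity and measurement *)

Definition symform (R : pzRingType) n (Om : 'M[R]_n) : Prop :=
  Om^T = - Om /\ Om *m Om = - 1%:M.

(** The real form of [is_qcm]; all later work on states uses it, for single and composite systems
    alike. *)
Definition qcm (R : rcfType) n (Om V : 'M[R]_n) : Prop :=
  V^T = V /\ forall x y, 0 <= bf V x x + bf V y y + 2 * bf Om x y.

Section Qcm.
Context {R : rcfType}.

Lemma symform_mulT n (Om : 'M[R]_n) : symform Om -> Om *m Om^T = 1%:M.
Proof. by move=> [-> e]; rewrite mulmxN e opprK. Qed.

Lemma symform_Tmul n (Om : 'M[R]_n) : symform Om -> Om^T *m Om = 1%:M.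
Proof. by move=> [-> e]; rewrite mulNmx e opprK. Qed.

Lemma symform_unit n (Om : 'M[R]_n) : symform Om -> Om \in unitmx.
Proof. by move=> /symform_mulT /mulmx1_unit[]. Qed.

Lemma symform_Omega m : symform (Omega m : 'M[R]_(m + m)).
Proof.
split; first by rewrite tr_block_mx opp_block_mx linearN /= !trmx1 !trmx0 !oppr0 opprK.
rewrite mulmx_block !mul0mx !mulmx0 !mul1mx !mulmx1 !addr0 !add0r.
by rewrite [in RHS]scalar_mx_block opp_block_mx !oppr0.
Qed.

Lemma symform_dirsum m n (O1 : 'M[R]_m) (O2 : 'M[R]_n) :
  symform O1 -> symform O2 -> symform (dirsum O1 O2).
Proof.
move=> [t1 s1] [t2 s2]; split.
  by rewrite tr_block_mx opp_block_mx !trmx0 !oppr0 t1 t2.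
rewrite mulmx_block !mul0mx !mulmx0 !addr0 !add0r s1 s2.
by rewrite [in RHS]scalar_mx_block opp_block_mx !oppr0.
Qed.

Lemma is_qcmP n (Om V : 'M[R]_n) : symform Om -> is_qcm Om V <-> qcm Om V.
Proof. by move=> [aO _]; split=> -[sV h]; split=> //; apply/(uncertaintyP aO sV). Qed.

Lemma qcm_neg n (Om V : 'M[R]_n) x y : qcm Om V -> 0 <= bf V x x + bf V y y - 2 * bf Om x y.
Proof. by move=> [_ /(_ x (- y))]; rewrite !bfNr !bfNl; lra. Qed.

Lemma qcm_psd n (Om V : 'M[R]_n) : qcm Om V -> psd V.
Proof. by move=> [sV h]; split=> // u; have := h u 0; rewrite bf0l bf0r mulr0 !addr0. Qed.

(** Along a null vector [u] of [V] the uncertainty form is affine with slope proportional to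
    [bf Om u v], so its positivity forces [u *m Om = 0]. *)
Lemma qcm_pd n (Om V : 'M[R]_n) : symform Om -> qcm Om V -> pd V.
Proof.
move=> sO qV; apply: pd_of_unit; first exact: qcm_psd qV.
rewrite -row_free_unit; apply: inj_row_free => u uV.
have h v : bf Om u v = 0.
  apply/eqP/negP=> /negP b0.
  have := proj2 qV (- (bf V v v + 1) / (2 * bf Om u v) *: u) v.
  have zV w : bf V u w = 0 by rewrite /bf uV mul0mx mxE.
  rewrite bfZl bfZl zV mulr0.
  have -> : - (bf V v v + 1) / (2 * bf Om u v) * bf Om u v = - (bf V v v + 1) / 2 by field.
  clear; lra.
have uO : u *m Om = 0.
  by apply/rowP=> j; move: (h (delta_mx 0 j)); rewrite /bf trmx_delta -colE !mxE.
by rewrite -[u]mulmx1 -(symform_mulT sO) mulmxA uO mul0mx.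
Qed.

(** The uncertainty form minimised over its first argument, the minimiser being
    [u *m Om *m invmx V]. *)
Lemma qcm_ge_dual n (Om V : 'M[R]_n) : symform Om -> qcm Om V ->
  psd (V - Om *m invmx V *m Om^T).
Proof.
move=> sO qV; have pV := qcm_pd sO qV; have uV := pd_unit pV; split=> [|u].
  by rewrite linearB /= !trmx_mul trmxK trmx_inv (proj1 pV) mulmxA.
have := proj2 qV (u *m Om *m invmx V) u.
have -> : bf V (u *m Om *m invmx V) (u *m Om *m invmx V) = bf (Om *m invmx V *m Om^T) u u.
  rewrite bfMl mulVmx // bfMr mul1mx trmx_inv (proj1 pV).
  by rewrite bfMr bfMl mulmxA.
have -> : bf Om (u *m Om *m invmx V) u = - bf (Om *m invmx V *m Om^T) u u.
  by rewrite !bfMl (proj1 sO) mulmxN bfmxN opprK mulmxA.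
by rewrite bfmxB; clear; lra.
Qed.

Lemma det_symform n (Om A : 'M[R]_n) : symform Om -> \det (Om *m A *m Om^T) = \det A.
Proof.
by move=> sO; rewrite !det_mulmx mulrAC -det_mulmx symform_mulT // det1 mul1r.
Qed.

(** The two sides are comparable by [qcm_ge_dual] and both have determinant 1, so [det_le_eq]
    identifies them. *)
Lemma pure_qcm_dual n (Om V : 'M[R]_n) : symform Om -> qcm Om V -> \det V = 1 ->
  Om *m invmx V *m Om^T = V.
Proof.
move=> sO qV d1; have pV := qcm_pd sO qV; apply: det_le_eq (qcm_ge_dual sO qV) _.
  by apply: pd_congr (pd_inv pV); rewrite row_free_unit symform_unit.
by rewrite det_symform // det_inv d1 invr1.
Qed.

Lemma pure_qcm_symp n (Om V : 'M[R]_n) : symform Om -> qcm Om V -> \det V = 1 ->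
  V *m Om *m V = Om.
Proof.
move=> sO qV d1; rewrite -{1}(pure_qcm_dual sO qV d1) -[_ *m Om^T *m Om]mulmxA symform_Tmul //.
by rewrite mulmx1 -mulmxA mulVmx ?mulmx1 //; apply: pd_unit; exact: qcm_pd qV.
Qed.

Lemma symp_dual n (Om V : 'M[R]_n) : symform Om -> V *m Om *m V = Om ->
  Om *m invmx V *m Om^T = V.
Proof.
move=> sO e; have uV : V \in unitmx.
  by have := symform_unit sO; rewrite -{1}e !unitmx_mul -andbA => /andP[].
by rewrite -{1}e mulmxK // -mulmxA symform_mulT // mulmx1.
Qed.

Lemma symp_det n (Om V : 'M[R]_n) : symform Om -> pd V -> V *m Om *m V = Om -> \det V = 1.
Proof.
move=> sO pV /(congr1 (fun M => \det M)); rewrite !det_mulmx mulrAC => e.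
have d0 : \det Om != 0 by have := symform_unit sO; rewrite unitmxE unitfE.
have {}e : \det V * \det V = 1 by apply: (mulIf d0); rewrite e mul1r.
move/eqP: e; rewrite -expr2 sqrf_eq1 => /orP[/eqP//|/eqP e].
by have := pd_det_gt0 pV; rewrite e ltr0N1.
Qed.

Lemma qcm1 n (Om : 'M[R]_n) : symform Om -> qcm Om 1%:M.
Proof.
move=> sO; split=> [|x y]; first exact: trmx1.
have := proj2 (pd_psd (pd1 n)) (x *m Om + y).
rewrite !(bfDl, bfDr) !bfMl !bfMr mulmx1 mul1mx symform_mulT //.
have -> : bf Om^T y x = bf Om x y by rewrite bf_tr.
lra.
Qed.

Lemma qcm_block_ul m n (O1 : 'M[R]_m) (O2 : 'M[R]_n) V B C W :
  qcm (dirsum O1 O2) (block_mx V B C W) -> qcm O1 V.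
Proof.
move=> [s h]; move: s; rewrite tr_block_mx => /eq_block_mx[sV _ _ _]; split=> // x y.
by have := h (row_mx x 0) (row_mx y 0); rewrite !bf_block !bf0l !bf0r !addr0.
Qed.

Lemma qcm_block_dr m n (O1 : 'M[R]_m) (O2 : 'M[R]_n) V B C W :
  qcm (dirsum O1 O2) (block_mx V B C W) -> qcm O2 W.
Proof.
move=> [s h]; move: s; rewrite tr_block_mx => /eq_block_mx[_ _ _ sV]; split=> // x y.
by have := h (row_mx 0 x) (row_mx 0 y); rewrite !bf_block !bf0l !bf0r !add0r.
Qed.

(* The state of the first system after a measurement of the second one with seed G. *)
Lemma qcm_cond m n (O1 : 'M[R]_m) (O2 : 'M[R]_n) V C W G : symform O2 ->
  qcm (dirsum O1 O2) (block_mx V C C^T W) -> qcm O2 G ->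
  qcm O1 (V - C *m invmx (W + G) *m C^T).
Proof.
move=> sO qg qG; have qW := qcm_block_dr qg; have sV := proj1 (qcm_block_ul qg).
have pWG := pdDr (qcm_pd sO qW) (qcm_psd qG); set T := invmx (W + G).
have uT := pd_unit pWG; have sT : T^T = T by rewrite trmx_inv (proj1 pWG).
split=> [|x y]; first by rewrite linearB /= !trmx_mul trmxK sT sV mulmxA.
have := proj2 qg (row_mx x (- (x *m C *m T))) (row_mx y (- (y *m C *m T))).
have := qcm_neg (x *m C *m T) (y *m C *m T) qG.
have f (z : 'rV[R]_m) : bf V z z - bf C z (z *m C *m T) - bf C^T (z *m C *m T) z +
    bf W (z *m C *m T) (z *m C *m T) + bf G (z *m C *m T) (z *m C *m T) =
    bf (V - C *m T *m C^T) z z.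
  rewrite -addrA -bfmxD [bf C^T _ _]bf_tr bfmxB !(bfMl, bfMr) !sT !mulmxA.
  by rewrite -[C *m T *m (W + G)]mulmxA mulVmx // mulmx1; ring.
rewrite -!f !bf_block !bfNr !bfNl !bfmx0; lra.
Qed.

Lemma symp_blockE m n (O1 : 'M[R]_m) (O2 : 'M[R]_n) V C W :
  block_mx V C C^T W *m dirsum O1 O2 *m block_mx V C C^T W = dirsum O1 O2 ->
  [/\ V *m O1 *m V = O1 - C *m O2 *m C^T, V *m O1 *m C = - (C *m O2 *m W),
      C^T *m O1 *m V = - (W *m O2 *m C^T) & C^T *m O1 *m C = O2 - W *m O2 *m W].
Proof.
rewrite /dirsum !mulmx_block !mulmx0 !addr0 !add0r => /eq_block_mx[e1 e2 e3 e4].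
split.
- by rewrite -[in RHS]e1 addrK.
- by apply/eqP; rewrite -addr_eq0 e2.
- by apply/eqP; rewrite -addr_eq0 e3.
by apply/eqP; rewrite eq_sym subr_eq e4.
Qed.

(** A measurement with a pure seed leaves a pure state. Between [C] and [C^T] everything collects
    into the left-hand side of [bracket], whose value [O2] cancels the defect
    [O1 - V *m O1 *m V]. *)
Lemma symp_cond m n (O1 : 'M[R]_m) (O2 : 'M[R]_n) V C W G : W + G \in unitmx ->
  block_mx V C C^T W *m dirsum O1 O2 *m block_mx V C C^T W = dirsum O1 O2 ->
  G *m O2 *m G = O2 ->
  let A := V - C *m invmx (W + G) *m C^T in A *m O1 *m A = O1.
Proof.
move=> u /symp_blockE[e1 e2 e3 e4] eG; set S := W + G; set T := invmx S => A.
have TS : T *m S = 1%:M by rewrite mulVmx.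
have ST : S *m T = 1%:M by rewrite mulmxV.
have bracket : T *m (W *m O2) + O2 *m (W *m T) + T *m (O2 - W *m O2 *m W) *m T = O2.
  have hG : S *m O2 *m S - W *m O2 *m S - (S *m O2 *m W - W *m O2 *m W) = O2.
    by rewrite -!mulmxBl -mulmxBr [S - W]addrC addKr.
  have -> : O2 - W *m O2 *m W = S *m O2 *m S - W *m O2 *m S - S *m O2 *m W.
    by rewrite -{1}hG opprB addrA addrAC addrK.
  rewrite !mulmxBr !mulmxBl !mulmxA TS mul1mx.
  rewrite -[(O2 *m S *m T)]mulmxA ST mulmx1 -[T *m W *m O2 *m S *m T]mulmxA ST mulmx1.
  by rewrite -[(O2 - _ - _)]addrA -opprD [LHS]addrC subrK.
rewrite /A; set K := C *m T; transitivity (V *m O1 *m V - K *m (C^T *m O1 *m V)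
    - (V *m O1 *m C) *m (T *m C^T) + K *m (C^T *m O1 *m C) *m (T *m C^T)).
  by rewrite !(mulmxBl, mulmxBr) !mulmxA opprB addrA addrAC; congr (_ + _); exact: addrAC.
rewrite e1 e2 e3 e4 /K mulmxN mulNmx !opprK.
transitivity (O1 - C *m O2 *m C^T +
   C *m (T *m (W *m O2) + O2 *m (W *m T) + T *m (O2 - W *m O2 *m W) *m T) *m C^T).
  by rewrite !(mulmxDr, mulmxDl) !mulmxA !addrA.
by rewrite bracket subrK.
Qed.

(** Both sides are the determinant of [1%:M + A *m Om *m G *m Om^T]. *)
Lemma det_dual n (Om A G : 'M[R]_n) : symform Om -> A \in unitmx -> G \in unitmx ->
  \det G * \det (A + Om *m invmx G *m Om^T) = \det A * \det (Om *m invmx A *m Om^T + G).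
Proof.
move=> sO uA uG; have sT := symform_mulT sO; have Ts := symform_Tmul sO.
have i (X : 'M[R]_n) : Om *m (Om *m X *m Om^T) *m Om^T = X.
  have TT : Om^T *m Om^T = - 1%:M by rewrite -trmx_mul (proj2 sO) linearN /= trmx1.
  by rewrite !mulmxA (proj2 sO) -mulmxA TT mulNmx mul1mx mulmxN mulmx1 opprK.
rewrite -[\det G](det_symform _ sO) mulrC -det_mulmx.
rewrite -[\det (_ *m _ *m _ + G)](det_symform _ sO) -det_mulmx; congr (\det _).
rewrite mulmxDl [in RHS]mulmxDr mulmxDl mulmxDr i mulmxV // addrC; congr (_ + _).
by rewrite !mulmxA -[_ *m Om^T *m Om]mulmxA Ts mulmx1 -[_ *m G]mulmxA mulVmx // mulmx1.
Qed.

(* A pure state extremises the left-hand side among the states below A, and submodularity of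
   log det carries the comparison from that pure state to A itself. *)
Lemma det_qcm_le n (Om A0 A' A G : 'M[R]_n) : symform Om ->
  pd A0 -> A0 *m Om *m A0 = Om -> psd (A - A0) ->
  qcm Om A' -> psd (A - A') -> qcm Om G ->
  \det (A + G) <= \det A * \det (A' + G).
Proof.
move=> sO p0 s0 l0 q' l' qG.
have pA := pd_le p0 l0; have p' := qcm_pd sO q'; have pG := qcm_pd sO qG.
set Am := Om *m invmx A *m Om^T; set Gm := Om *m invmx G *m Om^T.
have fO : row_free Om by rewrite row_free_unit symform_unit.
have pAm : pd Am by apply: pd_congr (pd_inv pA).
have pGm : pd Gm by apply: pd_congr (pd_inv pG).
have lA' : psd (A' - Am).
  by apply: psd_trans (qcm_ge_dual sO q'); apply/psd_congrB/psd_inv_anti.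
apply: (@le_trans _ _ (\det A * \det (Am + G))); last first.
  rewrite ler_pM2l ?pd_det_gt0 //; apply: det_le; first exact: pdDr (pd_psd pG).
  by rewrite opprD addrACA subrr addr0.
(* As [Gm] lies below [G], submodularity applies to the increment [G - Gm]. By [det_dual] the
   determinants with [Gm] turn into ones with [G], and since [A0] is its own dual the factor
   [\det (A0 + G)] cancels. *)
have := det_submod (pdDr p0 (pd_psd pGm)) (M' := A + Gm) (H := G - Gm).
have -> : A + Gm - (A0 + Gm) = A - A0 by rewrite opprD addrACA subrr addr0.
have r (X : 'M[R]_n) : X + Gm + (G - Gm) = X + G by rewrite addrCA addrAC [X + _]addrC subrK addrC.
rewrite !r => /(_ l0 (qcm_ge_dual sO qG)).
rewrite -(ler_pM2l (pd_det_gt0 pG)) !mulrA !det_dual ?pd_unit //.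
have d0 := symp_det sO p0 s0; rewrite (symp_dual sO s0) d0 mul1r.
by rewrite mulrC ler_pM2r //; apply/pd_det_gt0/pdDr/pd_psd.
Qed.

(** A Schur complement cancels [\det (B + GB)]; what remains is [det_qcm_le], with [A'] the state
    left on the first system by the measurement of the second. *)
Lemma pure_mutual_info_le m n (O1 : 'M[R]_m) (O2 : 'M[R]_n) A C B GA GB :
  symform O1 -> symform O2 -> qcm (dirsum O1 O2) (block_mx A C C^T B) ->
  \det (block_mx A C C^T B) = 1 -> qcm O1 GA -> qcm O2 GB ->
  \det (A + GA) * \det (B + GB) <=
  \det A * \det (block_mx (A + GA) C C^T (B + GB)).
Proof.
move=> s1 s2 q d1 qA qB; have s12 := symform_dirsum s1 s2.
have qA0 := qcm_block_ul q; have pB := qcm_pd s2 (qcm_block_dr q).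
have pBG := pdDr pB (qcm_psd qB); have pB1 := pdDr pB (pd_psd (pd1 n)).
have below X : pd X -> psd (A - (A - C *m invmx X *m C^T)).
  by move=> /pd_inv/pd_psd/(psd_congr C); rewrite opprB addrC subrK.
rewrite (det_schur_dr _ _ _ (pd_unit pBG)) mulrCA [leLHS]mulrC ler_pM2l ?pd_det_gt0 //.
rewrite addrAC.
(* The vacuum seed [1%:M] is pure, so it leaves the pure state below [A] that [det_qcm_le] asks
   for. *)
have q0 := qcm_cond s2 q (qcm1 s2).
apply: (det_qcm_le s1 (qcm_pd s1 q0) _ (below _ pB1) (qcm_cond s2 q qB) (below _ pBG) qA).
apply: symp_cond (pure_qcm_symp s12 q d1) _; first exact: pd_unit.
by rewrite mul1mx mulmx1.
Qed.

End Qcm.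

(** * Group inverses of matrices *)

Section GroupInverse.
Context {F : fieldType}.

(** The hypothesis equates the ranks of [A] and [A *m A], so [A] factors as [Z *m A *m A] and as
    [A *m A *m Z']; then [Z *m A *m Z'] is the group inverse. *)
Lemma group_inverse n (A : 'M[F]_n) : (forall v : 'rV[F]_n, v *m A *m A = 0 -> v *m A = 0) ->
  exists E, [/\ A *m E = E *m A, A *m E *m A = A & E *m A *m E = E].
Proof.
move=> kA.
have rk : \rank (A *m A) = \rank A.
  apply/eqP; rewrite eqn_leq mxrankM_maxl /=.
  have : (kermx (A *m A) <= kermx A)%MS.
    apply/sub_kermxP/row_matrixP=> i; rewrite row_mul row0; apply: kA.
    by rewrite -!row_mul -mulmxA mulmx_ker row0.
  move/mxrankS; rewrite !mxrank_ker => h.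
  by move: h; rewrite leq_sub2lE ?rank_leq_row.
have /submxP[Z eZ] : (A <= A *m A)%MS by rewrite -(geq_leqif (mxrank_leqif_sup (submxMl A A))) rk.
have /submxP[Z' eZ'] : (A^T <= A^T *m A^T)%MS.
  by rewrite -(geq_leqif (mxrank_leqif_sup (submxMl A^T A^T))) -trmx_mul !mxrank_tr rk.
have {}eZ' : A = A *m A *m Z'^T by rewrite -[LHS]trmxK eZ' !trmx_mul !trmxK.
rewrite mulmxA in eZ; move: {Z'}Z'^T eZ' => Z' eZ'.
have c : Z *m A = A *m Z' by rewrite {1}eZ' !mulmxA -eZ.
have AE : A *m (Z *m A *m Z') = A *m Z' by rewrite c !mulmxA -eZ'.
have EA : (Z *m A *m Z') *m A = A *m Z'.
  by rewrite -[Z *m A *m Z']mulmxA -c -[Z *m (Z *m A) *m A]mulmxA -eZ.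
exists (Z *m A *m Z'); split; first by rewrite AE EA.
  by rewrite AE -c -eZ.
by rewrite EA -c -mulmxA AE mulmxA.
Qed.

(** Both sides equal [EA *m N *m EB *m B], because a group inverse commutes with its matrix. *)
Lemma group_inverse_intertwine m n (A EA : 'M[F]_m) (B EB : 'M[F]_n) (N : 'M[F]_(m, n)) :
  A *m EA = EA *m A -> EA *m A *m EA = EA -> B *m EB = EB *m B -> B *m EB *m B = B ->
  EB *m B *m EB = EB -> A *m EA *m A = A ->
  A *m N = N *m B -> EA *m N = N *m EB.
Proof.
move=> cA eA cB bB eB aA AN.
have e1 : EA = EA *m EA *m A by rewrite -mulmxA -cA mulmxA.
have e2 : EB = B *m EB *m EB by rewrite cB.
have -> : EA *m N = EA *m N *m EB *m B.
  rewrite {1}e1 -mulmxA AN -{1}bB !mulmxA -[EA *m EA *m N *m B]mulmxA -AN.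
  by rewrite !mulmxA -e1.
have -> : N *m EB = A *m EA *m N *m EB.
  rewrite {1}e2 !mulmxA -AN -{1}aA -[_ *m A *m N]mulmxA AN -!mulmxA.
  by rewrite [B *m (EB *m EB)]mulmxA -e2.
by rewrite cA -[EA *m A *m N]mulmxA AN -!mulmxA cB.
Qed.

End GroupInverse.

(** * Complex matrices as real ones of twice the size *)

Section Doubling.
Context {R : rcfType}.

(* The real matrix of the complex matrix A + i B, acting on rows (x, y) standing for x + i y. *)
Definition cmx m n (A B : 'M[R]_(m, n)) : 'M[R]_(m + m, n + n) := block_mx A B (- B) A.

Lemma cmxM m n p (A B : 'M[R]_(m, n)) (A' B' : 'M[R]_(n, p)) :
  cmx A B *m cmx A' B' = cmx (A *m A' - B *m B') (A *m B' + B *m A').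
Proof.
by rewrite /cmx mulmx_block !mulNmx !mulmxN opprD [- _ + A *m A']addrC [- (A *m _) - _]addrC.
Qed.

Lemma cmx_tr m n (A B : 'M[R]_(m, n)) : (cmx A B)^T = cmx A^T (- B^T).
Proof. by rewrite /cmx tr_block_mx linearN /= opprK. Qed.

Lemma cmxB m n (A B A' B' : 'M[R]_(m, n)) : cmx A B - cmx A' B' = cmx (A - A') (B - B').
Proof. by rewrite /cmx opp_block_mx add_block_mx opprB opprK [- B + _]addrC. Qed.

Lemma cmxN m n (A B : 'M[R]_(m, n)) : - cmx A B = cmx (- A) (- B).
Proof. by rewrite /cmx opp_block_mx. Qed.

Lemma cmx0 m n : cmx (0 : 'M[R]_(m, n)) 0 = 0.
Proof. by rewrite /cmx oppr0 block_mx0. Qed.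

Lemma qcm_cmx n (Om V : 'M[R]_n) : Om^T = - Om -> qcm Om V <-> psd (cmx V Om).
Proof.
move=> aO.
have f x y : bf (cmx V Om) (row_mx x y) (row_mx x y) = bf V x x + bf V y y + 2 * bf Om x y.
  by rewrite bf_block bfmxN -[bf Om y x]bf_tr aO bfmxN; ring.
split=> [[sV h]|[s p]].
  split=> [|u]; first by rewrite cmx_tr sV aO opprK.
  by rewrite -[u]hsubmxK f.
move: s; rewrite cmx_tr => /eq_block_mx[sV _ _ _]; split=> // x y.
by rewrite -f.
Qed.

Lemma psd_cmx0 n (D : 'M[R]_n) : psd D -> psd (cmx D 0).
Proof.
move=> [sD pD]; split=> [|u]; first by rewrite cmx_tr sD trmx0 oppr0.
by rewrite -[u]hsubmxK bf_block oppr0 !bfmx0 !addr0 addr_ge0.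
Qed.

(** This is M^2 <= c M for 0 <= M <= c, obtained without a square root by testing [M] at
    [z - c^-1 *: (z *m M)]. *)
Lemma psd_sqr_le n (M : 'M[R]_n) (c : R) z : 0 < c -> psd M -> psd (c%:M - M) ->
  bf 1%:M (z *m M) (z *m M) <= c * bf M z z.
Proof.
move=> c0 pM [_ /(_ (z *m M)) h]; have [sM] := pM; move/(_ (z - c^-1 *: (z *m M))).
rewrite !(bfDl, bfDr, bfNl, bfNr, bfZl, bfZr).
have -> : bf M (z *m M) z = bf 1%:M (z *m M) (z *m M) by rewrite [RHS]bfMr mul1mx sM.
have -> : bf M z (z *m M) = bf 1%:M (z *m M) (z *m M) by rewrite [RHS]bfMl mulmx1.
move: h; rewrite bfmxB -[c%:M]scalemx1 bfmxZ; set q := bf 1%:M _ _; set r := bf M (_ *m _) _ => h1 h2.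
rewrite -subr_ge0.
have -> : c * bf M z z - q =
    c * (bf M z z - c^-1 * q - (c^-1 * q - c^-1 * (c^-1 * r))) + c^-1 * (c * q - r).
  by field; rewrite gt_eqF.
by apply: addr_ge0; apply: mulr_ge0; rewrite ?invr_ge0 ?(ltW c0) //; lra.
Qed.

End Doubling.

(** * Approximating states below V by measurements of the purifying system *)

Section Steering.
Context {R : rcfType}.

(** As V + i O may be singular, [- B] replaces its inverse as an outer inverse, and [C *m L] is only
    required to fix the matrices [D] dominated by V + i O. Both [L] and [B] come from the group
    inverse [E] of [F]. *)
Lemma pure_block_pinv n k (O : 'M[R]_n) (o : 'M[R]_k) V C W :
  symform O -> symform o -> pd V ->
  block_mx V C C^T W *m dirsum O o *m block_mx V C C^T W = dirsum O o ->
  exists (L : 'M[R]_(k, n)) (B : 'M[R]_(n + n)),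
  [/\ cmx W o *m cmx L 0 = - (cmx C^T 0 *m B),
      B *m cmx V O *m B^T = - B &
      forall D, psd D -> psd (cmx V O - cmx D 0) -> C *m L *m D = D].
Proof.
move=> [tO sO] [_ so] pV /symp_blockE[e1 _ e3 _]; have sV := proj1 pV.
have [F dF] : exists F, F = C *m o *m C^T *m O by exists (C *m o *m C^T *m O).
(* Purity gives [C *m o *m C^T = O - V *m O *m V], which expresses [F] through [V] and [O] alone. *)
have eF : F = - 1%:M - V *m O *m V *m O.
  have -> : F = (O - V *m O *m V) *m O by rewrite dF e1 opprB addrC subrK.
  by rewrite mulmxBl sO.
have FT : F^T = - 1%:M - O *m V *m O *m V.
  rewrite eF linearB linearN /= trmx1 !trmx_mul sV tO !(mulNmx, mulmxN) opprK.
  by rewrite !mulmxA.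
have FV : F *m V = V *m F^T by rewrite FT eF mulmxBl mulmxBr mulNmx mulmxN mul1mx mulmx1 !mulmxA.
have FO : F *m O = O *m F^T.
  rewrite FT eF mulmxBl mulmxBr mulNmx mulmxN mul1mx mulmx1 !mulmxA sO.
  by rewrite -[_ *m O *m O]mulmxA sO !mulNmx !mul1mx mulmxN mulmx1.
have [E [cE FEF EFE]] : exists E, [/\ F *m E = E *m F, F *m E *m F = F & E *m F *m E = E].
  (* By [FV], [F] is self-adjoint for the inner product [V], so [F *m F] kills no more vectors than
     [F]. *)
  apply: group_inverse => v vFF; have [//|nz] := eqVneq (v *m F) 0.
  have := proj2 pV _ nz; rewrite bfMr -FV.
  rewrite /bf !mulmxA. by rewrite vFF !mul0mx mxE ltxx.
have cE' : F^T *m E^T = E^T *m F^T by rewrite -!trmx_mul cE.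
have FEF' : F^T *m E^T *m F^T = F^T by rewrite -!trmx_mul mulmxA FEF.
have EFE' : E^T *m F^T *m E^T = E^T by rewrite -!trmx_mul mulmxA EFE.
have EV := group_inverse_intertwine cE EFE cE' FEF' EFE' FEF FV.
have EO := group_inverse_intertwine cE EFE cE' FEF' EFE' FEF FO.
exists (o *m C^T *m O *m E), (cmx (O *m V *m O *m E) (O *m E)); split.
- rewrite !cmxM !mulmx0 !mul0mx cmxN subr0 addr0 subr0 add0r; congr cmx.
    by rewrite !mulmxA e3 !mulNmx opprK.
  by rewrite !mulmxA so !mulNmx mul1mx.
- have -> : (cmx (O *m V *m O *m E) (O *m E))^T = cmx (E^T *m O *m V *m O) (E^T *m O).
    by rewrite cmx_tr !trmx_mul sV tO !(mulmxN, mulNmx) !opprK !mulmxA.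
  rewrite -mulmxA cmxM.
  have -> : V *m (E^T *m O *m V *m O) - O *m (E^T *m O) = - (E *m F).
    rewrite !mulmxA -EV -EO eF mulmxBr mulmxN mulmx1 -!mulmxA sO mulmxN mulmx1.
    by rewrite !mulmxA opprK opprB opprK addrC.
  have -> : V *m (E^T *m O) + O *m (E^T *m O *m V *m O) = 0.
    rewrite !mulmxA -EV -EO -[E *m O *m O]mulmxA sO mulmxN mulmx1 !mulNmx.
    by rewrite subrr.
  rewrite cmxM !mulmx0 subr0 add0r cmxN !mulmxN -!mulmxA.
  by have -> : E *m (E *m F) = E by rewrite -cE mulmxA.
move=> D pD lD.
have CL : C *m (o *m C^T *m O *m E) = F *m E by rewrite dF !mulmxA.
(* With [P] the projection 1 - F E, this encodes (P V O + i P)(V + i O) = 0. Domination carries the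
   vanishing over to [D], and the imaginary part then reads [P *m D = 0]. *)
have K0 : cmx ((1%:M - F *m E) *m (V *m O)) (1%:M - F *m E) *m cmx V O = 0.
  rewrite cmxM; set P := 1%:M - F *m E; have PF : P *m F = 0.
    by rewrite mulmxBl mul1mx FEF subrr.
  have -> : P *m (V *m O) *m V - P *m O = 0.
    rewrite -mulmxA -mulmxBr.
    have -> : V *m O *m V - O = F *m O.
      by rewrite eF mulmxBl mulNmx mul1mx -[_ *m O *m O]mulmxA sO mulmxN mulmx1 opprK addrC.
    by rewrite mulmxA PF mul0mx.
  have -> : P *m (V *m O) *m O + P *m V = 0.
    by rewrite -!mulmxA sO !mulmxN mulmx1 addNr.
  exact: cmx0.
have := psd_dominated_ker (psd_cmx0 pD) lD K0.
rewrite cmxM !mulmx0 add0r -cmx0 => /eq_block_mx[_ + _ _].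
by rewrite mulmxBl mul1mx CL => /eqP; rewrite subr_eq0 => /eqP.
Qed.

Lemma qcm_block_form n k (O : 'M[R]_n) (o : 'M[R]_k) V C W a z :
  O^T = - O -> o^T = - o -> qcm (dirsum O o) (block_mx V C C^T W) ->
  0 <= bf (cmx V O) a a + 2 * bf (cmx C 0) a z + bf (cmx W o) z z.
Proof.
move=> tO to [_ h]; rewrite -[a]hsubmxK -[z]hsubmxK !bf_block.
have := h (row_mx (lsubmx a) (lsubmx z)) (row_mx (rsubmx a) (rsubmx z)).
rewrite !bf_block !bfmxN !bfmx0 ![bf C^T _ _]bf_tr.
rewrite -[bf O (rsubmx a) _]bf_tr tO -[bf o (rsubmx z) _]bf_tr to !bfmxN; lra.
Qed.

(** With M = W + i o and Z = L D L^T the claim reads M Z M <= M, a form of Z^-1 >= M that makes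
    sense for singular Z. It follows from positivity of the whole state at the pair [u *m B],
    [z]. *)
Lemma pure_block_contract n k (O : 'M[R]_n) (o : 'M[R]_k) V C W L B D :
  O^T = - O -> o^T = - o -> qcm (dirsum O o) (block_mx V C C^T W) ->
  cmx W o *m cmx L 0 = - (cmx C^T 0 *m B) -> B *m cmx V O *m B^T = - B ->
  psd D -> psd (cmx V O - cmx D 0) ->
  forall z, bf (cmx (L *m D *m L^T) 0) (z *m cmx W o) (z *m cmx W o) <= bf (cmx W o) z z.
Proof.
move=> tO to q ML BNB pD lD z; set u := z *m cmx C^T 0.
have -> : cmx (L *m D *m L^T) 0 = cmx L 0 *m cmx D 0 *m (cmx L 0)^T.
  by rewrite cmx_tr !cmxM !trmx0 !oppr0 !(mulmx0, mul0mx, subr0, addr0).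
rewrite -bfMr -bfMl -!mulmxA ML !mulmxN bfNr bfNl opprK !mulmxA -/u.
have eN : bf (cmx V O) (u *m B) (u *m B) = - bf B u u.
  by rewrite bfMr bfMl mulmxA BNB bfmxN.
have eC : bf (cmx C 0) (u *m B) z = bf B u u.
  by rewrite [RHS]bfMr bfMl cmx_tr trmxK trmx0 oppr0.
have := proj2 lD (u *m B); have := qcm_block_form (u *m B) z tO to q.
by rewrite bfmxB eN eC; clear; lra.
Qed.

Lemma psd_sandwich n (g D K : 'M[R]_n) (s k1 k2 e h : R) : psd g -> psd D -> psd K ->
  psd (k1 *: g - D) -> psd (k2 *: g - K) -> 0 <= e -> 0 <= h ->
  e * k1 <= s - 1 -> h * k2 <= 1 - s^-1 ->
  let t := g + D - ((1 - e) *: D + h *: K) in psd (s *: g - t) /\ psd (t - s^-1 *: g).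
Proof.
move=> pg pD pK p1 p2 e0 h0 ek hk t; split.
  have -> : s *: g - t = e *: (k1 *: g - D) + (s - 1 - e * k1) *: g + h *: K.
    by apply/matrixP=> i j; rewrite !mxE; ring.
  by apply: psdD (psdZ h0 pK); apply: psdD (psdZ e0 p1) (psdZ _ pg); rewrite subr_ge0.
have -> : t - s^-1 *: g = h *: (k2 *: g - K) + (1 - s^-1 - h * k2) *: g + e *: D.
  by apply/matrixP=> i j; rewrite !mxE; ring.
by apply: psdD (psdZ e0 pD); apply: psdD (psdZ h0 p2) (psdZ _ pg); rewrite subr_ge0.
Qed.

Lemma steering n k (O : 'M[R]_n) (o : 'M[R]_k) V C W g (s : R) :
  symform O -> symform o -> qcm (dirsum O o) (block_mx V C C^T W) ->
  \det (block_mx V C C^T W) = 1 -> qcm O g -> psd (V - g) -> 1 < s ->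
  exists2 G, qcm o G &
    let t := V - C *m invmx (W + G) *m C^T in psd (s *: g - t) /\ psd (t - s^-1 *: g).
Proof.
move=> sO so q d1 qg lg s1.
have sy := pure_qcm_symp (symform_dirsum sO so) q d1.
have pV := qcm_pd sO (qcm_block_ul q); have pg := qcm_pd sO qg.
have qW := qcm_block_dr q; have sW := proj1 qW.
have [L [B [ML BNB CLD]]] := pure_block_pinv sO so pV sy.
have lD : psd (cmx V O - cmx (V - g) 0).
  by rewrite cmxB subr0 opprB addrC subrK; apply/(qcm_cmx _ (proj1 sO)).
have con := pure_block_contract (proj1 sO) (proj1 so) q ML BNB lg lD.
have CLD' := CLD _ lg lD.
set D := V - g in lg lD con CLD'.
have pM : psd (cmx W o) by apply/(qcm_cmx _ (proj1 so)).
have [c c0 hc] := psd_le_scal (proj1 pM).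
have [k1 k10 hk1] := psd_le_pd pg (proj1 lg).
have CCs : (C *m C^T)^T = C *m C^T by rewrite trmx_mul trmxK.
have [k2 k20 hk2] := psd_le_pd pg CCs.
have s0 : 0 < s by lra.
have si : 0 < 1 - s^-1 by rewrite subr_gt0 invf_lt1.
(* [e] shrinks [L *m D *m L^T], and [h] adds the multiple of the identity that makes [Z] invertible.
   The first bounds keep [t] within a factor [s] of [g]; [h * c <= e] lets the shrinking pay for the
   added term. *)
pose e := Num.min 1 ((s - 1) / k1); pose h := Num.min ((1 - s^-1) / k2) (e / c).
have e0 : 0 < e by rewrite lt_min ltr01 divr_gt0 // subr_gt0.
have e1 : e <= 1 by rewrite ge_min lexx.
have ek : e * k1 <= s - 1 by rewrite -ler_pdivlMr // ge_min lexx orbT.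
have h0 : 0 < h by rewrite lt_min !divr_gt0.
have hk : h * k2 <= 1 - s^-1 by rewrite -ler_pdivlMr // ge_min lexx.
have hc' : h * c <= e by rewrite -ler_pdivlMr // ge_min lexx orbT.
pose Z := (1 - e) *: (L *m D *m L^T) + h *: 1%:M.
have pZ : pd Z.
  rewrite /Z addrC; apply: pdDr; first by apply: pdZ => //; apply: pd1.
  by apply: psdZ; [rewrite subr_ge0|apply: psd_congr].
have CZC : C *m Z *m C^T = (1 - e) *: D + h *: (C *m C^T).
  rewrite mulmxDr mulmxDl -!scalemxAr -!scalemxAl mulmx1 !mulmxA CLD'.
  by rewrite -!mulmxA -trmx_mul -[D in LHS](proj1 lg) -trmx_mul CLD' (proj1 lg).
exists (invmx Z - W); last first.
  rewrite /= [W + _]addrC subrK invmxK CZC.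
  have -> : V = g + D by rewrite /D addrC subrK.
  apply: psd_sandwich (pd_psd pg) lg _ hk1 hk2 (ltW e0) (ltW h0) ek hk.
  by have := psd_congr C (pd_psd (pd1 _)); rewrite mulmx1.
split=> [|x y]; first by rewrite linearB /= trmx_inv (proj1 pZ) sW.
(* The goal says that Z^-1 dominates M = W + i o at [z], where [y] is negated to match the sign of
   [o]. It follows from [bf_inv_ge] at [w], since M Z M <= (1 - e) M + h c M <= M. *)
set z := row_mx x (- y); set w := z *m cmx W o.
have Mz : bf (cmx W o) z z = bf W x x + bf W y y - 2 * bf o x y.
  by rewrite bf_block bfmxN -[bf o (- y) x]bf_tr (proj1 so) bfmxN !bfNl !bfNr; ring.
have wM : bf 1%:M z w = bf (cmx W o) z z by rewrite /w bfMr mul1mx (proj1 pM).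
have m0 := proj2 pM z.
have wl := psd_sqr_le z c0 pM hc; have wc := con z; rewrite -/w in wl wc.
have i1 := bf_inv_ge x (lsubmx w) pZ; have i2 := bf_inv_ge (- y) (rsubmx w) pZ.
have f1 (u v : 'rV[R]_(k + k)) :
    bf 1%:M u v = bf 1%:M (lsubmx u) (lsubmx v) + bf 1%:M (rsubmx u) (rsubmx v).
  by rewrite -[u in LHS]hsubmxK -[v in LHS]hsubmxK scalar_mx_block bf_block !bfmx0 !addr0.
rewrite f1 /z row_mxKl row_mxKr -/z in wM; rewrite (f1 w w) in wl.
rewrite -[w]hsubmxK bf_block oppr0 !bfmx0 !addr0 in wc.
rewrite !bfmxB; rewrite Mz in wM wl wc m0.
move: i1 i2; rewrite !(bfNl, bfNr) opprK /Z !(bfmxD, bfmxZ).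
rewrite bfNl in wM.
move: wM wl wc m0 hc' (ltW e0) e1 (ltW h0) c0; clear.
set p1 := bf (L *m _ *m _) _ _; set p2 := bf (L *m _ *m _) (rsubmx w) _.
set m := _ - 2 * bf o x y; set q1 := bf 1%:M (lsubmx w) _; set q2 := bf 1%:M (rsubmx w) _.
move=> wM wl wc m0 hce e0 e1 h0 c0 i1 i2.
have b1 : (1 - e) * (p1 + p2) <= (1 - e) * m by rewrite ler_wpM2l // subr_ge0.
have b2 : h * (q1 + q2) <= h * (c * m) by rewrite ler_wpM2l.
have b3 : h * c * m <= e * m by rewrite ler_wpM2r.
move: wM b1 b2 b3 i1 i2; rewrite /m; lra.
Qed.

End Steering.

(** * Log-determinant information and the upper bound *)

Section Information.
Context {R : realType}.

Lemma log2M (x y : R) : 0 < x -> 0 < y -> log2 (x * y) = log2 x + log2 y.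
Proof. by move=> x0 y0; rewrite /log2 lnM ?posrE // mulrDl. Qed.

Lemma ln2_gt0 : 0 < ln 2 :> R.
Proof. by rewrite ln_gt0 // ltr1n. Qed.

Lemma ler_log2 (x y : R) : 0 < x -> x <= y -> log2 x <= log2 y.
Proof.
move=> x0 xy; rewrite ler_pM2r ?invr_gt0 ?ln2_gt0 // ler_ln ?posrE //; exact: lt_le_trans xy.
Qed.

Lemma log2_near1 N (d : R) : 0 < d -> exists2 c, 0 < c &
  forall s, 0 <= s -> s <= c -> 2^-1 * log2 ((1 + s) ^+ N) <= d.
Proof.
move=> d0; have l2 := ln2_gt0.
(* The estimate is ln (1 + s) <= s; dividing by [N.+1] keeps the constant positive when [N] is 0. *)
exists (d * ln 2 / N.+1%:R); first by rewrite !(mulr_gt0, divr_gt0, ltr0Sn).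
move=> s s0 sc; rewrite /log2 lnXn; last by lra.
have : ln (1 + s) <= s by apply: le_ln1Dx; lra.
move=> ls; have ls0 : 0 <= ln (1 + s) by apply: ln_ge0; lra.
have : ln (1 + s) *+ N <= d * ln 2.
  apply: (@le_trans _ _ (ln (1 + s) *+ N.+1)); first by rewrite mulrS lerDr.
  rewrite -[_ *+ N.+1]mulr_natr -ler_pdivlMr ?ltr0Sn //; exact: le_trans sc.
rewrite -ler_pdivrMr // => h.
have : 0 <= ln (1 + s) *+ N / ln 2 by rewrite divr_ge0 // ?mulrn_wge0 // ltW.
lra.
Qed.

Definition log_det_mi a b (T : 'M[R]_(a + b)) : R :=
  2^-1 * log2 (\det (ulsubmx T) * \det (drsubmx T) / \det T).

(** Each of the four determinants contains the factor [\det (drsubmx W)], which cancels; Schur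
    complements of principal blocks are principal blocks of the Schur complement. *)
Lemma cond_mutual_info_schur a b e (W : 'M[R]_(a + b + e)) : drsubmx W \in unitmx ->
  cond_mutual_info W =
  log_det_mi (ulsubmx W - ursubmx W *m invmx (drsubmx W) *m dlsubmx W).
Proof.
move=> uE; rewrite /cond_mutual_info /log_det_mi /blockAE /blockBE /blockE !det_schur_dr //.
have -> : \det W = \det (drsubmx W) *
    \det (ulsubmx W - ursubmx W *m invmx (drsubmx W) *m dlsubmx W).
  by rewrite -[W in LHS]submxK det_schur_dr.
set E := drsubmx W in uE *; set T := ulsubmx W - _.
have -> : ulsubmx (ulsubmx W) - usubmx (ursubmx W) *m invmx E *m lsubmx (dlsubmx W) = ulsubmx T.
  by rewrite /T /ulsubmx !linearB /= mulmx_lsub !mul_usub_mx.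
have -> : drsubmx (ulsubmx W) - dsubmx (ursubmx W) *m invmx E *m rsubmx (dlsubmx W) = drsubmx T.
  by rewrite /T /drsubmx !linearB /= mulmx_rsub !mul_dsub_mx.
have d0 : \det E != 0 by move: uE; rewrite unitmxE unitfE.
congr (_ * log2 _).
rewrite mulrACA [\det E * (\det E * _)]mulrA -mulf_div divff ?mul1r //.
by rewrite mulf_neq0.
Qed.

Lemma psd_ul a b (M : 'M[R]_(a + b)) : psd M -> psd (ulsubmx M).
Proof. by rewrite -{1}[M]submxK; apply: psd_block_ul. Qed.

Lemma psd_dr a b (M : 'M[R]_(a + b)) : psd M -> psd (drsubmx M).
Proof. by rewrite -{1}[M]submxK; apply: psd_block_dr. Qed.

Lemma pd_ul a b (M : 'M[R]_(a + b)) : pd M -> pd (ulsubmx M).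
Proof. by rewrite -{1}[M]submxK; apply: pd_block_ul. Qed.

Lemma pd_dr a b (M : 'M[R]_(a + b)) : pd M -> pd (drsubmx M).
Proof. by rewrite -{1}[M]submxK; apply: pd_block_dr. Qed.

Lemma psd_dirsum a b (A : 'M[R]_a) (B : 'M[R]_b) : psd A -> psd B -> psd (dirsum A B).
Proof.
move=> [sA pA] [sB pB]; split=> [|u]; first by rewrite tr_block_mx !trmx0 sA sB.
by rewrite -[u]hsubmxK bf_block !bfmx0 !addr0 addr_ge0.
Qed.

Lemma ulsubmxD a b (M N : 'M[R]_(a + b)) : ulsubmx (M + N) = ulsubmx M + ulsubmx N.
Proof. by rewrite -{1}[M]submxK -{1}[N]submxK add_block_mx block_mxKul. Qed.

Lemma drsubmxD a b (M N : 'M[R]_(a + b)) : drsubmx (M + N) = drsubmx M + drsubmx N.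
Proof. by rewrite -{1}[M]submxK -{1}[N]submxK add_block_mx block_mxKdr. Qed.

Lemma sym_block a b (M : 'M[R]_(a + b)) : M^T = M ->
  M = block_mx (ulsubmx M) (ursubmx M) (ursubmx M)^T (drsubmx M).
Proof.
rewrite -{1 2}[M]submxK tr_block_mx => /eq_block_mx[_ _ e _].
by rewrite e submxK.
Qed.

Lemma measured_info_schur a b e (gam : 'M[R]_(a + b + e)) GA GB GE :
  drsubmx gam + GE \in unitmx ->
  cond_mutual_info (gam + dirsum (dirsum GA GB) GE) =
  log_det_mi (ulsubmx gam - ursubmx gam *m invmx (drsubmx gam + GE) *m dlsubmx gam
              + dirsum GA GB).
Proof.
have -> : gam + dirsum (dirsum GA GB) GE =
    block_mx (ulsubmx gam + dirsum GA GB) (ursubmx gam) (dlsubmx gam) (drsubmx gam + GE).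
  by rewrite -{1}[gam]submxK add_block_mx !addr0.
move=> u; rewrite cond_mutual_info_schur block_mxKdr // block_mxKul block_mxKur block_mxKdl.
by rewrite addrAC.
Qed.

Lemma det_le_scale n (s : R) (A B : 'M[R]_n) : pd A -> psd (s *: B - A) ->
  \det A <= s ^+ n * \det B.
Proof. by move=> pA /(det_le pA); rewrite detZ. Qed.

(** The upper bound on [t] costs [s ^+ a] and [s ^+ b] in the numerator, the lower one
    [s ^+ (a + b)] in the denominator; between them stands [pure_mutual_info_le] for [g]. *)
Lemma log_det_mi_upper a b (O1 : 'M[R]_a) (O2 : 'M[R]_b) (g t : 'M[R]_(a + b)) s GA GB :
  symform O1 -> symform O2 -> qcm (dirsum O1 O2) g -> \det g = 1 ->
  1 < s -> psd (s *: g - t) -> psd (t - s^-1 *: g) -> qcm O1 GA -> qcm O2 GB ->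
  log_det_mi (t + dirsum GA GB) <=
  2^-1 * log2 (\det (ulsubmx g)) + 2^-1 * log2 (s ^+ (a + b + (a + b))).
Proof.
move=> s1 s2 qg dg sgt1 up lo qA qB; have s12 := symform_dirsum s1 s2.
have pg := qcm_pd s12 qg; have s0 : 0 < s by lra.
have si0 : 0 < s^-1 by rewrite invr_gt0.
have pA := qcm_psd qA; have pB := qcm_psd qB; set Gm := dirsum GA GB.
have pG : psd Gm by exact: psd_dirsum.
have pt : pd t by apply: pd_le lo; apply: pdZ.
have pT := pdDr pt pG; have pgG := pdDr pg pG.
(* Adding the same noise to both sides keeps the bound because [s] exceeds 1. *)
have upG n (X Y G : 'M[R]_n) : psd (s *: X - Y) -> psd G -> psd (s *: (X + G) - (Y + G)).
  move=> h hG; have -> : s *: (X + G) - (Y + G) = (s *: X - Y) + (s - 1) *: G.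
    by rewrite scalerDr opprD addrACA scalerBl scale1r.
  by apply: psdD h (psdZ _ hG); lra.
have hT : \det (g + Gm) <= s ^+ (a + b) * \det (t + Gm).
  apply: det_le_scale => //; apply: upG => //.
  have := psdZ (ltW s0) lo; rewrite scalerBr scalerA mulfV ?scale1r // gt_eqF //.
have hA : \det (ulsubmx t + GA) <= s ^+ a * \det (ulsubmx g + GA).
  apply: det_le_scale; first exact: pdDr (pd_ul pt) pA.
  apply: upG => //; have := psd_ul up; rewrite ulsubmxD /ulsubmx !linearN /= !linearZ //.
have hB : \det (drsubmx t + GB) <= s ^+ b * \det (drsubmx g + GB).
  apply: det_le_scale; first exact: pdDr (pd_dr pt) pB.
  apply: upG => //; have := psd_dr up; rewrite drsubmxD /drsubmx !linearN /= !linearZ //.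
have hg : \det (ulsubmx g + GA) * \det (drsubmx g + GB) <= \det (ulsubmx g) * \det (g + Gm).
  have e := sym_block (proj1 qg).
  have -> : g + Gm = block_mx (ulsubmx g + GA) (ursubmx g) (ursubmx g)^T (drsubmx g + GB).
    by rewrite {1}e add_block_mx !addr0.
  by apply: (pure_mutual_info_le s1 s2); rewrite -?e.
rewrite /log_det_mi ulsubmxD drsubmxD block_mxKul block_mxKdr -mulrDr ler_pM2l ?invr_gt0 ?ltr0n //.
have dT := pd_det_gt0 pT; have dgA := pd_det_gt0 (pd_ul pg).
have dA := pd_det_gt0 (pdDr (pd_ul pt) pA); have dB := pd_det_gt0 (pdDr (pd_dr pt) pB).
rewrite -log2M //; last by rewrite exprn_gt0.
apply: ler_log2; first by rewrite divr_gt0 // mulr_gt0.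
rewrite ler_pdivrMr //; apply: (le_trans (ler_pM (ltW dA) (ltW dB) hA hB)).
rewrite mulrACA -exprD [s ^+ (a + b + _)]exprD; have sn := exprn_gt0 (a + b) s0.
set x := s ^+ (a + b) in hT sn *.
rewrite [leRHS](_ : _ = x * (\det (ulsubmx g) * (x * \det (t + Gm)))); last by ring.
rewrite ler_pM2l //; apply: le_trans hg _; by rewrite ler_pM2l.
Qed.

(** [GE] is chosen before [GA] and [GB]: the order of quantifiers that bounds an infimum of
    suprema. *)
Lemma cond_mutual_info_upper a b e (O1 : 'M[R]_a) (O2 : 'M[R]_b) (o : 'M[R]_e)
    (gam : 'M[R]_(a + b + e)) (g : 'M[R]_(a + b)) d :
  symform O1 -> symform O2 -> symform o ->
  qcm (dirsum (dirsum O1 O2) o) gam -> \det gam = 1 ->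
  qcm (dirsum O1 O2) g -> \det g = 1 -> psd (ulsubmx gam - g) -> 0 < d ->
  exists2 GE, qcm o GE & forall GA GB, qcm O1 GA -> qcm O2 GB ->
    cond_mutual_info (gam + dirsum (dirsum GA GB) GE) <= 2^-1 * log2 (\det (ulsubmx g)) + d.
Proof.
move=> s1 s2 so qgam dgam qg dg lg d0; have s12 := symform_dirsum s1 s2.
have [c c0 hc] := log2_near1 (a + b + (a + b)) d0.
have eg := sym_block (proj1 qgam).
have sgt1 : 1 < 1 + c by lra.
have qgam' := qgam; have dgam' := dgam; rewrite eg in qgam' dgam'.
have [GE qE /= [up lo]] := steering s12 so qgam' dgam' qg lg sgt1.
exists GE => // GA GB qA qB.
have qE' : qcm o (drsubmx gam) by apply: qcm_block_dr; exact: qgam'.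
rewrite measured_info_schur; last first.
  apply: pd_unit; apply: pdDr (qcm_psd qE); exact: qcm_pd qE'.
have -> : dlsubmx gam = (ursubmx gam)^T by rewrite [in LHS]eg block_mxKdl.
apply: le_trans (log_det_mi_upper s1 s2 qg dg sgt1 up lo qA qB) _.
by rewrite lerD2l hc // ltW.
Qed.

End Information.

(* Columns of U and Y form a symplectic basis, with dual coordinates the rows of X (positions)
   and P (momenta). *)
Record darboux (R : pzRingType) n m (Om : 'M[R]_n) (U Y : 'M[R]_(n, m)) (X P : 'M[R]_(m, n)) :
    Prop := Darboux {
  darboux_XU : X *m U = 1%:M; darboux_XY : X *m Y = 0;
  darboux_PU : P *m U = 0; darboux_PY : P *m Y = 1%:M;
  darboux_id : U *m X + Y *m P = 1%:M;
  darboux_Om : Om = U *m Y^T - Y *m U^T }.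

(** * Darboux frames and states without position-momentum correlations *)

Section Darboux.
Context {R : realType}.

Lemma darboux_dirsum m n k l (O1 : 'M[R]_m) (O2 : 'M[R]_n) (U1 Y1 : 'M[R]_(m, k))
    (U2 Y2 : 'M[R]_(n, l)) X1 P1 X2 P2 :
  darboux O1 U1 Y1 X1 P1 -> darboux O2 U2 Y2 X2 P2 ->
  darboux (dirsum O1 O2) (block_mx U1 0 0 U2) (block_mx Y1 0 0 Y2)
    (block_mx X1 0 0 X2) (block_mx P1 0 0 P2).
Proof.
move=> [a1 a2 a3 a4 a5 a6] [b1 b2 b3 b4 b5 b6].
split; rewrite ?tr_block_mx ?trmx0 !mulmx_block !(mulmx0, mul0mx) !addr0 !add0r
  ?opp_block_mx ?add_block_mx ?oppr0 ?addr0.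
- by rewrite a1 b1 -scalar_mx_block.
- by rewrite a2 b2 block_mx0.
- by rewrite a3 b3 block_mx0.
- by rewrite a4 b4 -scalar_mx_block.
- by rewrite a5 b5 -scalar_mx_block.
by rewrite /dirsum a6 b6.
Qed.

Lemma darboux_Omega m :
  darboux (Omega m) (col_mx 1%:M 0) (col_mx 0 1%:M) (row_mx 1%:M 0)
    (row_mx 0 1%:M : 'M[R]_(m, m + m)).
Proof.
split; rewrite ?mul_row_col ?mul_col_row ?tr_col_mx ?trmx0 ?trmx1 ?mul_col_row
  ?mulmx0 ?mul0mx ?mulmx1 ?addr0 ?add0r //.
  by rewrite add_block_mx !addr0 !add0r -scalar_mx_block.
by rewrite opp_block_mx add_block_mx !oppr0 !addr0 !add0r.
Qed.

Lemma darboux_symplectic m n (Om S : 'M[R]_n) (U Y : 'M[R]_(n, m)) X P :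
  symform Om -> symplectic Om S -> darboux Om U Y X P ->
  darboux Om (invmx S *m U) (invmx S *m Y) (X *m S) (P *m S).
Proof.
move=> sO e [a1 a2 a3 a4 a5 a6].
have uS : S \in unitmx.
  by have := symform_unit sO; rewrite -{1}e !unitmx_mul -andbA => /andP[].
have c k (Z : 'M[R]_(k, n)) (T : 'M[R]_(n, m)) : Z *m S *m (invmx S *m T) = Z *m T.
  by rewrite mulmxA mulmxK.
split; rewrite ?c //.
  by rewrite !mulmxA -mulmxDl -!mulmxA -mulmxDr a5 mulmx1 mulVmx.
have h : Om = invmx S *m Om *m (invmx S)^T.
  by rewrite -{2}e trmx_inv !mulmxA mulVmx // mul1mx mulmxK // unitmx_tr.
by rewrite [LHS]h a6 mulmxBr mulmxBl !trmx_mul !mulmxA.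
Qed.

(* The pure state with position covariance q and momentum covariance q^-1. *)
Definition xp_pure n m (U Y : 'M[R]_(n, m)) (q : 'M[R]_m) : 'M[R]_n :=
  U *m q *m U^T + Y *m invmx q *m Y^T.

Section Frame.
Context {n m : nat} {Om : 'M[R]_n} {U Y : 'M[R]_(n, m)} {X P : 'M[R]_(m, n)}.
Context (sO : symform Om) (D : darboux Om U Y X P).

Let XU := darboux_XU D.
Let XY := darboux_XY D.
Let PU := darboux_PU D.
Let PY := darboux_PY D.

Lemma darboux_X_free : row_free X. Proof. by apply/row_freeP; exists U. Qed.

Lemma darboux_X_Om : X *m Om = Y^T.
Proof. by rewrite (darboux_Om D) mulmxBr !mulmxA XU XY mul1mx mul0mx subr0. Qed.

Lemma darboux_P_Om : P *m Om = - U^T.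
Proof. by rewrite (darboux_Om D) mulmxBr !mulmxA PU PY mul1mx mul0mx sub0r. Qed.

Lemma darboux_Yt_Om : Y^T *m Om = - X.
Proof. by rewrite -darboux_X_Om -mulmxA (proj2 sO) mulmxN mulmx1. Qed.

Lemma darboux_Ut_Om : U^T *m Om = P.
Proof. by rewrite -[U^T]opprK -darboux_P_Om mulNmx -mulmxA (proj2 sO) mulmxN mulmx1 opprK. Qed.

Lemma darboux_form x y :
  bf Om x y = bf 1%:M (x *m U) (y *m Y) - bf 1%:M (x *m Y) (y *m U).
Proof. by rewrite (darboux_Om D) bfmxB !(bfMl, bfMr) !mulmx1. Qed.

Lemma xp_pure_qcm q : pd q -> qcm Om (xp_pure U Y q).
Proof.
move=> pq; have sq := proj1 pq; split=> [|x y].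
  by rewrite linearD /= !trmx_mul !trmxK trmx_inv sq !mulmxA.
rewrite darboux_form !bfmxD -!bfMr -!bfMl.
have := bf_inv_ge (y *m Y) (- (x *m U)) pq; have := bf_inv_ge (x *m Y) (y *m U) pq.
rewrite !bfNl !bfNr (bfC (y *m Y) _ (trmx1 _ _)); lra.
Qed.

Lemma xp_pure_symp q : pd q -> xp_pure U Y q *m Om *m xp_pure U Y q = Om.
Proof.
move=> pq; have uq := pd_unit pq; rewrite mulmxDl -!mulmxA darboux_Ut_Om darboux_Yt_Om.
have Px : P *m xp_pure U Y q = invmx q *m Y^T by rewrite mulmxDr !mulmxA PU PY !mul0mx add0r mul1mx.
have Xx : X *m xp_pure U Y q = q *m U^T by rewrite mulmxDr !mulmxA XU XY !mul0mx addr0 mul1mx.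
rewrite mulmxDl -!mulmxA mulNmx Px Xx !mulmxN [q *m (_ *m _)]mulmxA mulmxV // mul1mx.
by rewrite [invmx q *m (_ *m _)]mulmxA mulVmx // mul1mx -(darboux_Om D).
Qed.

(** Heisenberg's relation for covariance matrices: the uncertainty form is minimised over position
    vectors while the momentum vector [u *m P] is held fixed. *)
Lemma qcm_momentum_ge q g : qcm Om g -> q = X *m g *m X^T -> psd (P *m g *m P^T - invmx q).
Proof.
move=> qg dq; have pq : pd q by rewrite dq; apply: pd_congr darboux_X_free (qcm_pd sO qg).
split=> [|u].
  by rewrite linearB /= !trmx_mul trmxK trmx_inv (proj1 qg) (proj1 pq) mulmxA.
have := proj2 qg (- (u *m invmx q) *m X) (u *m P).
have -> : bf g (- (u *m invmx q) *m X) (- (u *m invmx q) *m X) = bf (invmx q) u u.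
  rewrite bfMr bfMl mulmxA -dq bfNl bfNr opprK bfMl mulVmx ?pd_unit // bfMr mul1mx.
  by rewrite trmx_inv (proj1 pq).
have -> : bf Om (- (u *m invmx q) *m X) (u *m P) = - bf (invmx q) u u.
  by rewrite bfMr bfMl mulmxA darboux_X_Om -trmx_mul PY trmx1 bfNl bfMl mulmx1.
by rewrite bfmxB bfMr bfMl mulmxA; lra.
Qed.

(** Without cross terms [V] is a position part plus a momentum part, compared separately: [g] lies
    below [V] in position, and [invmx q] is at most the momentum covariance of [g], hence that of
    [V]. *)
Lemma xp_pure_le V g : V^T = V -> X *m V *m P^T = 0 -> qcm Om g -> psd (V - g) ->
  psd (V - xp_pure U Y (X *m g *m X^T)).
Proof.
move=> sV xV qg lg; set q := X *m g *m X^T.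
have PX : P *m V *m X^T = 0.
  by move/(congr1 trmx): xV; rewrite !trmx_mul trmxK sV trmx0 mulmxA.
have -> : V = U *m (X *m V *m X^T) *m U^T + Y *m (P *m V *m P^T) *m Y^T.
  rewrite -[LHS]mul1mx -[LHS]mulmx1 -{1}(darboux_id D) -trmx1 -(darboux_id D).
  rewrite linearD /= !trmx_mul mulmxDl mulmxDl !mulmxDr !mulmxA.
  have -> : U *m X *m V *m P^T = 0 by rewrite -!mulmxA [X *m (_ *m _)]mulmxA xV mulmx0.
  have -> : Y *m P *m V *m X^T = 0 by rewrite -!mulmxA [P *m (_ *m _)]mulmxA PX mulmx0.
  by rewrite !mul0mx addr0 add0r.
rewrite opprD addrACA; apply: psdD.
  by apply: psd_congrB; apply: psd_congrB.
apply: psd_congrB; apply: psd_trans (qcm_momentum_ge qg erefl) _.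
by apply: psd_congrB.
Qed.

End Frame.

End Darboux.

(** * The lower bound from position measurements *)

Section Lower.
Context {R : realType}.

Lemma xp_pure_compress n m (Om : 'M[R]_n) (U Y : 'M[R]_(n, m)) X P q :
  darboux Om U Y X P -> X *m xp_pure U Y q *m X^T = q.
Proof.
move=> D; rewrite mulmxDr !mulmxA (darboux_XU D) (darboux_XY D) !mul0mx addr0 mul1mx.
by rewrite -mulmxA -trmx_mul (darboux_XU D) trmx1 mulmx1.
Qed.

(** The matrix [row_mx U Y] preserves the symplectic form, so its determinant squares to 1. *)
Lemma det_darboux m (U Y : 'M[R]_(m + m, m)) X P (a b : 'M[R]_m) :
  darboux (Omega m) U Y X P -> \det (U *m a *m U^T + Y *m b *m Y^T) = \det a * \det b.
Proof.
move=> D; set F := row_mx U Y.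
have f (c d e f : 'M[R]_m) : F *m block_mx c d e f *m F^T =
    U *m c *m U^T + Y *m e *m U^T + (U *m d *m Y^T + Y *m f *m Y^T).
  by rewrite mul_row_block tr_row_mx mul_row_col !mulmxDl.
have <- : F *m dirsum a b *m F^T = U *m a *m U^T + Y *m b *m Y^T.
  by rewrite f !mulmx0 !mul0mx addr0 add0r.
have : F *m Omega m *m F^T = Omega m.
  by rewrite f !(mulmx0, mul0mx, addr0, add0r) mulmx1 mulmxN mulmx1 mulNmx addrC -(darboux_Om D).
move/(congr1 (fun M => \det M)); rewrite !det_mulmx !det_tr det_ublock => e.
have d0 : \det (Omega m : 'M[R]_(m + m)) != 0.
  by rewrite -unitfE -unitmxE; apply/symform_unit/symform_Omega.
have dF : \det F * \det F = 1 by apply: (mulIf d0); rewrite mul1r mulrAC.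
by rewrite mulrAC dF mul1r.
Qed.

(** Jacobi's identity for complementary minors. It turns the determinant of the A block of an
    [xp_pure] state into the mutual-information quotient of its positions. *)
Lemma det_inv_ul a b (q : 'M[R]_(a + b)) : q \in unitmx ->
  \det (ulsubmx (invmx q)) * \det q = \det (drsubmx q).
Proof.
move=> uq; have := mulmxV uq.
set r := invmx q; rewrite -{1}[q]submxK -{1}[r]submxK mulmx_block scalar_mx_block.
move/eq_block_mx=> [e1 _ e2 _].
have : q *m block_mx (ulsubmx r) 0 (dlsubmx r) 1%:M = block_mx 1%:M (ursubmx q) 0 (drsubmx q).
  by rewrite -{1}[q]submxK mulmx_block e1 e2 !mulmx0 !mulmx1 !add0r.
move/(congr1 (fun M => \det M)); rewrite det_mulmx det_lblock det_ublock !det1 mulr1 mul1r.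
by rewrite mulrC.
Qed.

(* Data processing for the log-determinant mutual information. *)
Lemma det_compress a b k l (A : 'M[R]_a) C (B : 'M[R]_b) (X1 : 'M[R]_(k, a)) (X2 : 'M[R]_(l, b)) :
  row_free X1 -> row_free X2 -> pd (block_mx A C C^T B) ->
  \det (X1 *m A *m X1^T) * \det (X2 *m B *m X2^T) * \det (block_mx A C C^T B) <=
  \det A * \det B *
    \det (block_mx X1 0 0 X2 *m block_mx A C C^T B *m (block_mx X1 0 0 X2)^T).
Proof.
move=> f1 f2 p; have pA := pd_block_ul p; have pB := pd_block_dr p.
have h1 := det_compress_ul f1 p.
have p1 : pd (block_mx (X1 *m A *m X1^T) (X1 *m C) (X1 *m C)^T B).
  have : row_free (block_mx X1 0 0 (1%:M : 'M[R]_b)).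
    have [Z1 e1] := row_freeP f1; apply/row_freeP; exists (block_mx Z1 0 0 1%:M).
    by rewrite mulmx_block !(mulmx0, mul0mx, addr0, add0r) e1 mulmx1 -scalar_mx_block.
  move/pd_congr/(_ p); rewrite tr_block_mx !mulmx_block !trmx0 trmx1.
  by rewrite !(mulmx0, mul0mx, addr0, add0r, mul1mx, mulmx1) trmx_mul.
have uA1 := pd_unit (pd_block_ul p1).
have := pd_block_swap p1; rewrite -{2}[X1 *m C]trmxK => p2.
have := det_compress_ul f2 p2; rewrite trmxK.
have uB1 : X2 *m B *m X2^T \in unitmx by apply/pd_unit/pd_congr.
rewrite -[in X in _ * X <= _]det_block_swap //.
have -> : \det (block_mx (X2 *m B *m X2^T) (X2 *m (X1 *m C)^T) (X2 *m (X1 *m C)^T)^T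
    (X1 *m A *m X1^T)) =
    \det (block_mx X1 0 0 X2 *m block_mx A C C^T B *m (block_mx X1 0 0 X2)^T).
  rewrite det_block_swap // tr_block_mx !mulmx_block !trmx0.
  by rewrite !(mulmx0, mul0mx, addr0, add0r) !trmx_mul !trmxK !mulmxA.
move=> h2.
rewrite [leLHS](_ : _ = \det (X2 *m B *m X2^T) *
  (\det (X1 *m A *m X1^T) * \det (block_mx A C C^T B))); last by ring.
apply: le_trans (_ : _ <= \det (X2 *m B *m X2^T) * (\det A * \det (block_mx
  (X1 *m A *m X1^T) (X1 *m C) (X1 *m C)^T B))) _.
  by rewrite ler_pM2l // pd_det_gt0 //; apply: pd_congr.
by rewrite mulrCA -mulrA ler_pM2l // pd_det_gt0.
Qed.

Lemma cond_mutual_info_lower mA mB mE (gam : 'M[R]_((mA + mA) + (mB + mB) + (mE + mE)))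
    (UA YA : 'M[R]_(mA + mA, mA)) XA PA (UB YB : 'M[R]_(mB + mB, mB)) XB PB (d : R) :
  let X := block_mx XA 0 0 XB in let P := block_mx PA 0 0 PB in
  darboux (Omega mA) UA YA XA PA -> darboux (Omega mB) UB YB XB PB ->
  X *m ulsubmx gam *m P^T = 0 -> qcm (OmegaABE mA mB mE) gam -> 0 < d ->
  exists GA GB, [/\ qcm (Omega mA) GA, qcm (Omega mB) GB &
    forall GE, qcm (Omega mE) GE -> exists g,
      [/\ qcm (OmegaAB mA mB) g, \det g = 1, psd (ulsubmx gam - g) &
      2^-1 * log2 (\det (ulsubmx g)) <=
      cond_mutual_info (gam + dirsum (dirsum GA GB) GE) + d]].
Proof.
move=> X P DA DB xV qgam d0.
have sA := @symform_Omega R mA; have sB := @symform_Omega R mB; have sE := @symform_Omega R mE.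
have sAB := symform_dirsum sA sB; have DAB := darboux_dirsum DA DB.
have eg := sym_block (proj1 qgam); set V := ulsubmx gam in xV eg *.
have qgam' := qgam; rewrite eg in qgam'.
have qV := qcm_block_ul qgam'; have qE' := qcm_block_dr qgam'.
(* [GA] and [GB] are fixed before [GE], so the error must be uniform: [c] bounds the momentum
   covariance of V, hence that of every [g] below it, and with it [invmx q]. *)
have [c c0 hc] := psd_le_scal (proj1 (psd_congr P (qcm_psd qV))).
have [r r0 hr] := log2_near1 (mA + mB) d0.
pose t := r / c; have t0 : 0 < t by rewrite divr_gt0.
have pt n : pd (t%:M : 'M[R]_n) by rewrite -scalemx1; apply/pdZ/pd1.
(* Position covariance [t] and momentum covariance [t^-1]: for small [t], almost perfect position
   measurements. *)
exists (xp_pure UA YA t%:M), (xp_pure UB YB t%:M).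
have qA := xp_pure_qcm DA (pt _); have qB := xp_pure_qcm DB (pt _); split=> // GE qE.
set GA := xp_pure UA _ _ in qA *; set GB := xp_pure UB _ _ in qB *.
have pWE := pdDr (qcm_pd sE qE') (qcm_psd qE).
pose g := V - ursubmx gam *m invmx (drsubmx gam + GE) *m (ursubmx gam)^T.
have qg : qcm (OmegaAB mA mB) g by apply: (qcm_cond sE qgam' qE).
have lg : psd (V - g).
  by rewrite /g opprB addrC subrK; apply: psd_congr; apply: pd_psd; apply: pd_inv.
set q := X *m g *m X^T; have pg := qcm_pd sAB qg.
have fX := darboux_X_free DAB; have pq : pd q by apply: pd_congr.
exists (xp_pure (block_mx UA 0 0 UB) (block_mx YA 0 0 YB) q).
have qx := xp_pure_qcm DAB pq; split=> //.
- exact: symp_det (qcm_pd sAB qx) (xp_pure_symp sAB DAB pq).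
- exact: (xp_pure_le sAB DAB (proj1 qV) xV qg lg).
rewrite measured_info_schur; last exact: pd_unit.
have -> : dlsubmx gam = (ursubmx gam)^T by rewrite [in LHS]eg block_mxKdl.
rewrite -/V -/g /log_det_mi.
set T := g + dirsum GA GB.
have pT : pd T by apply: pdDr pg _; apply: psd_dirsum; [apply: qcm_psd qA|apply: qcm_psd qB].
have eT := sym_block (proj1 pT); have eq := sym_block (proj1 pq).
have XT : X *m T *m X^T = q + t%:M.
  rewrite /T mulmxDr mulmxDl -/q; congr (_ + _).
  rewrite tr_block_mx !mulmx_block !trmx0 !(mulmx0, mul0mx, addr0, add0r).
  by rewrite /GA /GB (xp_pure_compress _ DA) (xp_pure_compress _ DB) -scalar_mx_block.
have := det_compress (darboux_X_free DA) (darboux_X_free DB) (A := ulsubmx T) (B := drsubmx T)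
  (C := ursubmx T).
rewrite -eT => /(_ pT); rewrite -/X XT => hT.
have XTblock : X *m T *m X^T = block_mx (XA *m ulsubmx T *m XA^T) (XA *m ursubmx T *m XB^T)
    (XB *m (ursubmx T)^T *m XA^T) (XB *m drsubmx T *m XB^T).
  rewrite {1}eT tr_block_mx !mulmx_block !trmx0.
  by rewrite !(mulmx0, mul0mx, addr0, add0r).
have eA : XA *m ulsubmx T *m XA^T = ulsubmx q + t%:M.
  by move/(congr1 ulsubmx): XTblock; rewrite block_mxKul XT ulsubmxD scalar_mx_block block_mxKul.
have eB : XB *m drsubmx T *m XB^T = drsubmx q + t%:M.
  by move/(congr1 drsubmx): XTblock; rewrite block_mxKdr XT drsubmxD scalar_mx_block block_mxKdr.
rewrite eA eB in hT.
have -> : \det (ulsubmx (xp_pure (block_mx UA 0 0 UB) (block_mx YA 0 0 YB) q)) =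
    \det (ulsubmx q) * \det (ulsubmx (invmx q)).
  rewrite -(det_darboux _ _ DA) /xp_pure ulsubmxD; congr (\det (_ + _)).
    rewrite -{1}[q]submxK tr_block_mx !mulmx_block !trmx0 block_mxKul.
    by rewrite !(mulmx0, mul0mx, addr0, add0r).
  rewrite -{1}[invmx q]submxK tr_block_mx !mulmx_block !trmx0 block_mxKul.
  by rewrite !(mulmx0, mul0mx, addr0, add0r).
have inv := det_inv_ul (pd_unit pq).
have dq := pd_det_gt0 pq; have dT := pd_det_gt0 pT.
have dTA := pd_det_gt0 (pd_ul pT); have dTB := pd_det_gt0 (pd_dr pT).
have dqA := pd_det_gt0 (pd_ul pq); have dqB := pd_det_gt0 (pd_dr pq).
have dal : 0 < \det (ulsubmx (invmx q)) by apply/pd_det_gt0/pd_ul/pd_inv.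
have mono k (M : 'M[R]_k) : pd M -> \det M <= \det (M + t%:M).
  by move=> pM; apply: det_le => //; rewrite addrC addKr; apply: pd_psd.
have hA := mono _ _ (pd_ul pq); have hB := mono _ _ (pd_dr pq).
(* Since [t * c = r] and [invmx q] is at most [c], the factor [1%:M + t *: invmx q] is at most
   [(1 + r)%:M]. *)
have hq : \det (q + t%:M) <= \det q * (1 + r) ^+ (mA + mB).
  have -> : q + t%:M = q *m (1%:M + t *: invmx q).
    by rewrite mulmxDr mulmx1 -scalemxAr mulmxV ?pd_unit // scalemx1.
  rewrite det_mulmx ler_pM2l // -[leRHS]det_scalar; apply: det_le.
    by apply: pdDr (pd1 _) _; apply: psdZ (ltW t0) _; apply/pd_psd/pd_inv.
  have -> : (1 + r)%:M - (1%:M + t *: invmx q) = t *: (c%:M - invmx q).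
    rewrite raddfD /= opprD addrACA subrr add0r scalerBr scale_scalar_mx.
    by rewrite /t divfK ?gt_eqF.
  apply: psdZ (ltW t0) _; apply: psd_trans (qcm_momentum_ge sAB DAB qg erefl) _.
  by apply: psd_trans hc; apply: psd_congrB.
apply: le_trans (_ : _ <= 2^-1 * log2 (\det (ulsubmx T) * \det (drsubmx T) / \det T) +
  2^-1 * log2 ((1 + r) ^+ (mA + mB))) _; last by rewrite lerD2l hr // ltW.
have r1 : 0 < (1 + r) ^+ (mA + mB) by rewrite exprn_gt0 // addr_gt0.
rewrite -mulrDr -log2M //; last by rewrite divr_gt0 // mulr_gt0.
rewrite ler_pM2l ?invr_gt0 ?ltr0n //; apply: ler_log2; first exact: mulr_gt0.
rewrite mulrAC ler_pdivlMr // -(ler_pM2r dq).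
rewrite [leLHS](_ : _ = \det (ulsubmx q) * \det (drsubmx q) * \det T); last first.
  by rewrite -inv; ring.
apply: le_trans (_ : _ <= \det (ulsubmx T) * \det (drsubmx T) * \det (q + t%:M)) _.
  apply: le_trans hT; rewrite ler_pM2r //; apply: ler_pM => //; exact: ltW.
rewrite -[leRHS]mulrA ler_pM2l ?mulr_gt0 // mulrC; exact: le_trans hq _.
Qed.

End Lower.

(** * Vanishing cross blocks, the minimax argument and the theorem *)

Lemma xp_form_cross (R : realType) mA mB (N : 'M[R]_((mA + mA) + (mB + mB))) : xp_form N ->
  block_mx (row_mx 1%:M 0) 0 0 (row_mx 1%:M 0) *m N *m
  (block_mx (row_mx 0 1%:M) 0 0 (row_mx 0 1%:M) : 'M[R]_(mA + mB, (mA + mA) + (mB + mB)))^T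
  = 0 :> 'M[R]_(mA + mB).
Proof.
move=> h; set X := block_mx (row_mx 1%:M 0) _ _ _; set P := block_mx _ _ _ _.
have hX i k : ~~ is_x_coord k -> X i k = 0.
  rewrite /is_x_coord /X /block_mx !mxE.
  case: (fintype.splitP i) => i' _; rewrite !mxE; case: (fintype.splitP k) => k' _;
    rewrite ?mxE //; case: (fintype.splitP k') => j _ //; by rewrite mxE.
have hP i k : is_x_coord k -> P i k = 0.
  rewrite /is_x_coord /P /block_mx !mxE.
  case: (fintype.splitP i) => i' _; rewrite !mxE; case: (fintype.splitP k) => k' _;
    rewrite ?mxE //; case: (fintype.splitP k') => j _ //; by rewrite mxE.
apply/matrixP=> i j; rewrite !mxE big1 // => l _; rewrite [P^T _ _]mxE [(X *m N) _ _]mxE.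
case xl: (is_x_coord l); first by rewrite hP // mulr0.
rewrite big1 ?mul0r // => k _; case xk: (is_x_coord k); last by rewrite hX ?xk // mul0r.
by rewrite h ?mulr0 // xk xl.
Qed.

(** The hypotheses give [u <= v] and [v <= l], and weak duality [l <= u] closes the cycle. Additive
    errors [d] stand in for optimisers. *)
Lemma ereal_minimax (R : realType) (TA TB TE TG : Type) (QA : set TA) (QB : set TB) (QE : set TE)
    (QG : set TG) (h : TG -> R) (f : TA -> TB -> TE -> R) :
  (forall g d, QG g -> 0 < d ->
    exists2 e, QE e & forall a b, QA a -> QB b -> f a b e <= h g + d) ->
  (forall d, 0 < d -> exists a b, [/\ QA a, QB b & forall e, QE e ->
    exists2 g, QG g & h g <= f a b e + d]) ->
  let v := ereal_inf [set (h g)%:E | g in QG] in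
  let u := ereal_inf [set ereal_sup [set (f a b e)%:E | a in QA & b in QB] | e in QE] in
  let l := ereal_sup [set ereal_inf [set (f a b e)%:E | e in QE] | a in QA & b in QB] in
  v = u /\ u = l.
Proof.
move=> up lo v u l.
have uv : (u <= v)%E.
  apply: le_ereal_inf_tmp => _ [g qg <-]; apply/lee_addgt0Pr => d d0.
  have [e qe he] := up _ _ qg d0.
  apply: (@le_trans _ _ (ereal_sup [set (f a b e)%:E | a in QA & b in QB])).
    by apply: ereal_inf_lbound; exists e.
  by apply: ge_ereal_sup => _ [a qa [b qb <-]]; rewrite -EFinD lee_fin he.
have vl : (v <= l)%E.
  apply/lee_addgt0Pr => d d0; have [a [b [qa qb hab]]] := lo _ d0.
  rewrite -leeBlDr //.
  apply: (@le_trans _ _ (ereal_inf [set (f a b e)%:E | e in QE])); last first.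
    by apply: ereal_sup_ubound; exists a => //; exists b.
  apply: le_ereal_inf_tmp => _ [e qe <-]; rewrite leeBlDr //; have [g qg hg] := hab _ qe.
  apply: (@le_trans _ _ (h g)%:E); last by rewrite -EFinD lee_fin.
  by apply: ereal_inf_lbound; exists g.
have lu : (l <= u)%E.
  apply: ge_ereal_sup => _ [a qa [b qb <-]]; apply: le_ereal_inf_tmp => _ [e qe <-].
  apply: (@le_trans _ _ (f a b e)%:E).
    by apply: ereal_inf_lbound; exists e.
  by apply: ereal_sup_ubound; exists a => //; exists b.
by split; apply/eqP; rewrite eq_le ?uv ?lu ?(le_trans vl lu) ?(le_trans uv vl).
Qed.

Theorem proposition8 (R : realType) (mA mB mE : nat)
    (V : 'M[R]_((mA + mA) + (mB + mB)))
    (gam : 'M[R]_((mA + mA) + (mB + mB) + (mE + mE)))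
    (Vnormal : normal_qcm V) (gamV : purification V gam) :
  EF2G V =
    ereal_inf [set ereal_sup [set measured_info gam GA GB GE |
                                GA in qcm_set mA & GB in qcm_set mB] |
                 GE in qcm_set mE] /\
  ereal_inf [set ereal_sup [set measured_info gam GA GB GE |
                              GA in qcm_set mA & GB in qcm_set mB] |
               GE in qcm_set mE] =
    ereal_sup [set ereal_inf [set measured_info gam GA GB GE |
                                GE in qcm_set mE] |
                 GA in qcm_set mA & GB in qcm_set mB].
Proof.
have sA := @symform_Omega R mA; have sB := @symform_Omega R mB; have sE := @symform_Omega R mE.
have sAB := symform_dirsum sA sB; have sABE := symform_dirsum sAB sE.
have [[qgam dgam] eV] := gamV; move/(is_qcmP _ sABE): qgam => qgam.
have [[sV _] [SA [SB [yA yB xp]]]] := Vnormal.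
have feas g : is_pure_qcm (OmegaAB mA mB) g /\ loewner_le (cplx_mx g) (cplx_mx V) <->
    [/\ qcm (OmegaAB mA mB) g, \det g = 1 & psd (V - g)].
  split=> [[[qg dg] lg]|[qg dg lg]].
    split=> //; first exact/(is_qcmP _ sAB).
    exact/(loewner_leP (proj1 qg) sV).
  split; last exact/(loewner_leP (proj1 qg) sV).
  by split=> //; apply/(is_qcmP _ sAB).
apply: ereal_minimax => [g d [pg _ lg] d0|d d0].
  have [qg dg lg'] := (feas g).1 (conj pg lg).
  rewrite -eV in lg'.
  have [GE qE h] := cond_mutual_info_upper sA sB sE qgam dgam qg dg lg' d0.
  exists GE => [|GA GB qA qB]; first exact/(is_qcmP _ sE).
  by apply: h; [apply/(is_qcmP _ sA)|apply/(is_qcmP _ sB)].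
(* The standard frames are carried back by [SA] and [SB]; in the resulting frames [V] itself has no
   position-momentum cross block. *)
have DA := darboux_symplectic sA yA (darboux_Omega mA).
have DB := darboux_symplectic sB yB (darboux_Omega mB).
have [|GA [GB [qA qB h]]] := cond_mutual_info_lower DA DB _ qgam d0.
  have f a b c e (Z1 : 'M[R]_(a, b)) (Z2 : 'M[R]_(c, e)) T1 T2 :
      block_mx (Z1 *m T1) 0 0 (Z2 *m T2) = block_mx Z1 0 0 Z2 *m dirsum T1 T2.
    by rewrite mulmx_block !(mulmx0, mul0mx, addr0, add0r).
  by rewrite !f trmx_mul eV -!mulmxA -(xp_form_cross xp) !mulmxA.
exists GA, GB; split; [exact/(is_qcmP _ sA)|exact/(is_qcmP _ sB)|move=> GE qE].
have [|g [qg dg lg hg]] := h GE; first exact/(is_qcmP _ sE).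
rewrite eV in lg; have [pg lg'] := (feas g).2 (And3 qg dg lg).
by exists g; [exact: And3 pg (proj2 (proj1 pg)) lg'|exact: hg].
Qed.
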